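(* Let $A$ and $j:C\to A$ be as constructed in the context (for any choice of the data described there), and let $\tau$ be the normalized trace of the CAR algebra $C$. Then $\tau$ has a unique state extension $\widetilde\tau$ to $A$, i.e. there is exactly one state $\widetilde\tau$ of $A$ with $\widetilde\tau\circ j=\tau$. This extension is tracial and faithful, and it is the only tracial state of $A$.
   Context: Conventions. Algebras and Hilbert spaces are complex; inner products are linear in the first variable; for vectors $x,y$, $\theta_{x,y}z=\langle z,y\rangle x$. A state $\omega$ is faithful if $\omega(a^*a)=0$ implies $a=0$. Strong limits are limits in the strong operator topology. CAR algebra. $C=\overline{\bigcup_{n\ge0}C_n}$ with $C_n=M_2(\mathbb C)^{\otimes n}$ embedded in $C_{n+1}$ by $a\mapsto a\otimes1_2$. Its unique tracial state is $\tau(a)=2^{-n}\operatorname{Tr}(a)$, $a\in C_n$. Let $e_{00}\in M_2(\mathbb C)$ be the first diagonal matrix unit, $q_n=e_{00}^{\otimes n}\in C$ (so $q_0=1$ and $q_n$ is decreasing), and let $\phi_{\mathrm r}$ be the pure product state of $C$ selecting the first coordinate in each tensor factor, i.e. the product of the vector states $a\mapsto a_{00}$ on $M_2(\mathbb C)$. Pure-state data. Choose pure states $(\phi_i)_{i\in I}$ of $C$, with GNS triples $(H_i,\pi_i,\xi_i)$, such that $(\pi_i)_{i\in I}$ contains exactly one representative of each unitary equivalence class of irreducible representations of $C$, with a distinguished index $\mathrm r\in I$ corresponding to $\phi_{\mathrm r}$. For each $i\in I$ choose an automorphism $\alpha_i$ of $C$ with $\phi_i\circ\alpha_i=\phi_{\mathrm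 r}$ and $\alpha_{\mathrm r}=\mathrm{id}_C$ which is asymptotically inner: there is a norm-continuous path $t\mapsto u_{i,t}$ ($t\ge0$) of unitaries of $C$ with $u_{i,0}=1$ and $\lim_{t\to\infty}\|\alpha_i(a)-u_{i,t}au_{i,t}^*\|=0$ for all $a\in C$. (Such $\alpha_i$ exist by the Kishimoto–Ozawa–Sakai homogeneity theorem.) Put, for $n\ge0$, $p_{i,n}=\alpha_i(q_n)$, $f_n=q_n-q_{n+1}$, $e_{i,n}=p_{i,n}-p_{i,n+1}$. Choose $w_{i,n}\in C$ with $w_{i,n}^*w_{i,n}=e_{i,n}$, $w_{i,n}w_{i,n}^*=f_n$, $w_{\mathrm r,n}=f_n$ (such elements exist), and put $s_{i,N}=\sum_{n=0}^{N-1}w_{i,n}\in C$. The algebra. Let $H=\bigoplus_{i\in I}H_i$, $\Pi=\bigoplus_{i\in I}\pi_i:C\to\mathcal B(H)$, and let $\zeta_i\in H$ be the image of $\xi_i$ under the coordinate inclusion $H_i\to H$. Let $S_i$ be the strong limit of $\Pi(s_{i,N})$ as $N\to\infty$ (which exists) and $L_i=S_i+\theta_{\zeta_{\mathrm r},\zeta_i}$, which is a unitary on $H$. Define $A=C^*(\Pi(C),\{L_i:i\in I\})\subseteq\mathcal B(H)$, and $j:C\to A$, $j(a)=\Pi(a)$. *)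

(* Defs.v *)
From HB Require Import structures.
From mathcomp Require Import all_boot all_order all_algebra ring lra.
From mathcomp Require Import complex mxtens.
From mathcomp Require Import all_classical all_reals topology normedtype.
From mathcomp Require Import sequences.

Set Implicit Arguments.
Unset Strict Implicit.
Unset Printing Implicit Defensive.

Import Order.TTheory GRing.Theory Num.Theory.
Import numFieldNormedType.Exports Normc.
Local Open Scope classical_set_scope.
Local Open Scope complex_scope.
Local Open Scope ring_scope.

(* Complex Hilbert spaces. The zero space is excluded, so that the bounded
   operators form an algebra with 1 != 0, as required by algType. *)
HB.mixin Record isHilbert (R : realType) H & CompleteNormedModule R[i] H := {
  dotp : H -> H -> R[i];
  dotp_linear : forall (k : R[i]) (x y z : H),
    dotp (k *: x + y) z = k * dotp x z + dotp y z;
  dotpC : forall x y : H, dotp x y = Num.conj (dotp y x);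
  dotpxx : forall x : H, dotp x x = `|x| ^+ 2;
  hilbert_neq0 : exists x : H, x != 0 }.

#[short(type="hilbertType")]
HB.structure Definition Hilbert (R : realType) :=
  {H of CompleteNormedModule R[i] H & isHilbert R H}.

HB.mixin Record isStarAlgebra (R : realType) A & GRing.Algebra R[i] A := {
  star : A -> A;
  star_semilinear : forall (k : R[i]) (a b : A),
    star (k *: a + b) = Num.conj k *: star a + star b;
  starM : forall a b : A, star (a * b) = star b * star a;
  starK : forall a : A, star (star a) = a }.

#[short(type="starAlgType")]
HB.structure Definition StarAlgebra (R : realType) :=
  {A of GRing.Algebra R[i] A & isStarAlgebra R A}.

(* Cauchy and convergent sequences for a norm-like function N. *)
Definition cauchy_for (R : realType) (V : zmodType) (N : V -> R)
    (u : nat -> V) :=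
  forall e, 0 < e -> exists k, forall m n,
    (k <= m)%N -> (k <= n)%N -> N (u m - u n) < e.

Definition cvg_for (R : realType) (V : zmodType) (N : V -> R)
    (u : nat -> V) (l : V) :=
  forall e, 0 < e -> exists k, forall n, (k <= n)%N -> N (u n - l) < e.

(* Unital C*-algebras. The norm is a separate operation, because the library's
   ring and normed module hierarchies have no common join. *)
HB.mixin Record isCStarAlgebra (R : realType) A & StarAlgebra R A := {
  cnorm : A -> R;
  cnorm_eq0 : forall a : A, cnorm a = 0 -> a = 0;
  cnormD : forall a b : A, cnorm (a + b) <= cnorm a + cnorm b;
  cnormZ : forall (k : R[i]) (a : A),
    cnorm (k *: a) = normc k * cnorm a;
  cnormM : forall a b : A, cnorm (a * b) <= cnorm a * cnorm b;
  cnorm_star : forall a : A, cnorm (star a * a) = cnorm a ^+ 2;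
  cstar_complete : forall u : nat -> A,
    cauchy_for cnorm u -> exists l, cvg_for cnorm u l }.

#[short(type="cstarType")]
HB.structure Definition CStarAlgebra (R : realType) :=
  {A of StarAlgebra R A & isCStarAlgebra R A}.

Section NormcTheory.
Context {R : realType}.
Implicit Types k : R[i].
Lemma normC_normc k : (normc k)%:C = `|k|. Proof. by []. Qed.
Lemma normc_ge0 k : 0 <= normc k.
Proof. by rewrite -ler0c normC_normc. Qed.
Lemma normc_eq0 k : (normc k == 0) = (k == 0).
Proof. by rewrite -(inj_eq (@complexI R)) normC_normc normr_eq0. Qed.
Lemma normc_sqr k : (normc k ^+ 2)%:C = k * Num.conj k.
Proof. by rewrite rmorphXn /= normC_normc normCK. Qed.
Lemma normc_real (k : R) : normc k%:C = `|k|.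
Proof. by rewrite /normc /= expr0n addr0 sqrtr_sqr. Qed.
Lemma normc_conj k : normc (Num.conj k) = normc k.
Proof. by apply: complexI; rewrite !normC_normc norm_conjC. Qed.
End NormcTheory.

Section HilbertTheory.
Context {R : realType} {H : hilbertType R}.
Implicit Types (x y z : H) (k : R[i]).

Definition hnorm x : R := complex.Re `|x|.

Lemma hnormE x : (hnorm x)%:C = `|x|.
Proof. by rewrite RRe_real// ger0_real. Qed.

Lemma hnorm_ge0 x : 0 <= hnorm x.
Proof. by rewrite -ler0c hnormE. Qed.

Lemma dotpDl x y z : dotp (x + y) z = dotp x z + dotp y z.
Proof. by have := dotp_linear 1 x y z; rewrite scale1r mul1r. Qed.
Lemma dotp0l z : dotp 0 z = 0.
Proof. by apply: (addrI (dotp 0 z)); rewrite -dotpDl !addr0. Qed.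
Lemma dotpZl k x z : dotp (k *: x) z = k * dotp x z.
Proof. by have := dotp_linear k x 0 z; rewrite !addr0 dotp0l addr0. Qed.
Lemma dotpNl x z : dotp (- x) z = - dotp x z.
Proof. by rewrite -scaleN1r dotpZl mulN1r. Qed.
Lemma dotpBl x y z : dotp (x - y) z = dotp x z - dotp y z.
Proof. by rewrite dotpDl dotpNl. Qed.
Lemma dotpDr x y z : dotp z (x + y) = dotp z x + dotp z y.
Proof. by rewrite (dotpC z) dotpDl rmorphD /= -!dotpC. Qed.
Lemma dotpZr k x z : dotp z (k *: x) = Num.conj k * dotp z x.
Proof. by rewrite (dotpC z) dotpZl rmorphM /= -dotpC. Qed.
Lemma dotp0r z : dotp z 0 = 0.
Proof. by rewrite (dotpC z) dotp0l rmorph0. Qed.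
Lemma dotpNr x z : dotp z (- x) = - dotp z x.
Proof. by rewrite (dotpC z) dotpNl rmorphN /= -dotpC. Qed.
Lemma dotpBr x y z : dotp z (x - y) = dotp z x - dotp z y.
Proof. by rewrite dotpDr dotpNr. Qed.

Lemma hnorm_sqr x : (hnorm x ^+ 2)%:C = dotp x x.
Proof. by rewrite rmorphXn /= hnormE dotpxx. Qed.

Lemma hnorm_eq0 x : (hnorm x == 0) = (x == 0).
Proof. by rewrite -(inj_eq (@complexI R)) hnormE normr_eq0. Qed.

Lemma dotp_inj x y : (forall z, dotp z x = dotp z y) -> x = y.
Proof.
move=> xy; apply/eqP; rewrite -subr_eq0 -hnorm_eq0 -sqrf_eq0.
by rewrite -(inj_eq (@complexI R)) hnorm_sqr dotpBr xy subrr.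
Qed.

Lemma hnormZ k x : hnorm (k *: x) = normc k * hnorm x.
Proof. by apply: complexI; rewrite rmorphM /= !hnormE normrZ. Qed.
Lemma hnormD x y : hnorm (x + y) <= hnorm x + hnorm y.
Proof. by rewrite -lecR rmorphD /= !hnormE ler_normD. Qed.
Lemma hnormN x : hnorm (- x) = hnorm x.
Proof. by apply: complexI; rewrite !hnormE normrN. Qed.
Lemma hnorm0 : hnorm 0 = 0.
Proof. by apply: complexI; rewrite !hnormE normr0. Qed.
Lemma hnormB_ge x y : hnorm x - hnorm (x - y) <= hnorm y.
Proof. by rewrite lerBlDl; have := hnormD (x - y) y; rewrite subrK. Qed.

Lemma parallelogram x y :
  hnorm (x - y) ^+ 2 = 2 * hnorm x ^+ 2 + 2 * hnorm y ^+ 2 - hnorm (x + y) ^+ 2.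
Proof.
apply: complexI; rewrite !mulr_natl rmorphB rmorphD !rmorphMn /=.
rewrite 4!hnorm_sqr !(dotpDl, dotpBl, dotpNl, dotpDr, dotpBr, dotpNr).
set a := dotp x x; set b := dotp x y; set c := dotp y x; set d := dotp y y.
ring.
Qed.

Lemma hnorm_opp_proj x z : z != 0 ->
  hnorm (x - (dotp x z / (hnorm z ^+ 2)%:C) *: z) ^+ 2 =
  hnorm x ^+ 2 - normc (dotp x z) ^+ 2 / hnorm z ^+ 2.
Proof.
move=> z0; apply: complexI.
have nz : (hnorm z ^+ 2)%:C != 0.
  by rewrite (inj_eq (@complexI R)) sqrf_eq0 hnorm_eq0.
rewrite rmorphB fmorph_div /= !hnorm_sqr normc_sqr.
rewrite !(dotpDl, dotpBl, dotpNl, dotpDr, dotpBr, dotpNr, dotpZl, dotpZr).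
rewrite hnorm_sqr in nz *.
rewrite rmorphM fmorphV /= -!dotpC.
by field.
Qed.

Lemma hnorm_cauchy_schwarz x y : normc (dotp x y) <= hnorm x * hnorm y.
Proof.
have [->|y0] := eqVneq y 0.
  by rewrite dotp0r normc0 mulr_ge0 ?hnorm_ge0.
have yp : 0 < hnorm y by rewrite lt_neqAle eq_sym hnorm_eq0 y0 hnorm_ge0.
have := sqr_ge0 (hnorm (x - (dotp x y / (hnorm y ^+ 2)%:C) *: y)).
rewrite hnorm_opp_proj// subr_ge0 ler_pdivrMr ?exprn_gt0//.
by rewrite -exprMn ler_sqr ?nnegrE ?mulr_ge0 ?hnorm_ge0 ?normc_ge0.
Qed.

Lemma cauchy_schwarz x y : `|dotp x y| <= `|x| * `|y|.
Proof.
have := hnorm_cauchy_schwarz x y.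
by rewrite -lecR rmorphM /= !hnormE.
Qed.

Lemma cvg_for_dist (u : nat -> H) l : u @ \oo --> l -> cvg_for hnorm u l.
Proof.
move=> ul e e0; have := @cvgr_distC_lt _ _ _ _ _ _ _ ul e%:C.
rewrite ltcR => /(_ _ e0)[k _ uk]; exists k => n kn.
by rewrite -ltcR hnormE; exact: uk.
Qed.

Lemma hilbert_complete (u : nat -> H) :
  cauchy_for hnorm u -> exists l, cvg_for hnorm u l.
Proof.
move=> cu; have eE (e : R[i]) : 0 < e -> exists2 d : R, 0 < d & e = d%:C.
  move=> e0; have er : e = (complex.Re e)%:C by rewrite RRe_real// gtr0_real.
  by exists (complex.Re e); rewrite // -ltcR -er.
have /cauchy_cvgP/cvg_ex[l ul] : cauchy (u @ \oo).
  apply: cauchy_exP => e /eE[d d0 ->]; have [k uk] := cu _ d0.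
  exists (u k); exists k => // n /= kn.
  by rewrite -ball_normE /= -hnormE ltcR uk.
by exists l; exact: cvg_for_dist.
Qed.

Section Riesz.
Variables (f : H -> R[i]) (M : R).
Hypothesis fL : forall k x y, f (k *: x + y) = k * f x + f y.
Hypothesis fM : forall x, normc (f x) <= M * hnorm x.

Let f0 : f 0 = 0.
Proof.
by apply: (addrI (f 0)); have := fL 1 0 0; rewrite scale1r !addr0 mul1r => <-.
Qed.
Let fD x y : f (x + y) = f x + f y.
Proof. by have := fL 1 x y; rewrite scale1r mul1r. Qed.
Let fZ k x : f (k *: x) = k * f x.
Proof. by have := fL k x 0; rewrite f0 !addr0. Qed.
Let fB x y : f (x - y) = f x - f y.
Proof. by rewrite fD -scaleN1r fZ mulN1r. Qed.

Lemma riesz : exists y, forall x, f x = dotp x y.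
Proof.
have [f_eq0|] := pselect (forall x, f x = 0).
  by exists 0 => x; rewrite f_eq0 dotp0r.
move=> /existsNP[x0 /eqP fx0].
pose E : set R := [set hnorm x | x in [set x | f x = 1]].
have E0 : has_inf E.
  split; last by exists 0 => _ [x _ <-]; exact: hnorm_ge0.
  by exists (hnorm ((f x0)^-1 *: x0)); exists ((f x0)^-1 *: x0); rewrite //= fZ mulVf.
pose d := inf E.
have dle x : f x = 1 -> d <= hnorm x.
  by move=> fx; apply: (ge_inf E0.2); exists x.
have d0 : 0 <= d.
  by apply: lb_le_inf; [exact: E0.1 | move=> _ [x _ <-]; exact: hnorm_ge0].
have /choice[u uP] : forall n : nat, exists x, f x = 1 /\ hnorm x < d + n.+1%:R^-1.
  move=> n; have [|_ [x fx <-] xd] := @inf_adherent _ E n.+1%:R^-1 _ E0.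
    by rewrite invr_gt0 ltr0n.
  by exists x.
have half (x y : H) : f x = 1 -> f y = 1 -> 2 * d <= hnorm (x + y).
  move=> fx fy; have : f ((2^-1 : R[i]) *: (x + y)) = 1.
    by rewrite fZ fD fx fy mulVf// pnatr_eq0.
  move/dle; rewrite hnormZ (_ : 2^-1 = (2^-1 : R)%:C).
    by rewrite normc_real ger0_norm ?invr_ge0//; lra.
  by rewrite fmorphV rmorph_nat.
have cu : cauchy_for hnorm u.
  move=> e e0.
  pose del := Num.min 1 (e ^+ 2 / (8 * d + 8)).
  have del0 : 0 < del by rewrite lt_min ltr01 divr_gt0 ?exprn_gt0//; lra.
  have [k kdel] : exists k : nat, k.+1%:R^-1 < del.
    exists (Num.truncn del^-1); rewrite -[ltRHS]invrK ltf_pV2 ?posrE ?invr_gt0//.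
    by rewrite truncnS_gt.
  exists k => m n km kn.
  have bnd i : (k <= i)%N -> hnorm (u i) < d + del.
    move=> ki; apply: (lt_le_trans (uP i).2); rewrite lerD2l.
    by apply: le_trans (ltW kdel); rewrite lef_pV2 ?posrE ?ltr0n// ler_nat.
  have [bm bn] := (bnd _ km, bnd _ kn).
  rewrite -(@ltr_pXn2r _ 2) ?nnegrE ?hnorm_ge0 ?(ltW e0)// parallelogram.
  have mn := half _ _ (uP m).1 (uP n).1.
  have m0 := hnorm_ge0 (u m); have n0 := hnorm_ge0 (u n).
  have del1 : del <= 1 by rewrite ge_min lexx.
  have dele : del * (8 * d + 8) <= e ^+ 2.
    by rewrite -ler_pdivlMr ?ge_min ?lexx ?orbT//; lra.
  set A := hnorm (u m) in bm m0 *; set B := hnorm (u n) in bn n0 *.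
  set D := hnorm (u m + u n) in mn *.
  have A2 : A ^+ 2 < (d + del) ^+ 2 by rewrite ltr_pXn2r ?nnegrE//; lra.
  have B2 : B ^+ 2 < (d + del) ^+ 2 by rewrite ltr_pXn2r ?nnegrE//; lra.
  have D2 : (2 * d) ^+ 2 <= D ^+ 2 by rewrite ler_pXn2r ?nnegrE ?hnorm_ge0//; lra.
  have dd : del ^+ 2 <= del by rewrite expr2 ler_piMr// ltW.
  move: A2 B2 D2 dd dele; rewrite !exprMn !sqrrD; lra.
have [x ux] := hilbert_complete cu.
have fx : f x = 1.
  apply/eqP; rewrite -subr_eq0 -normc_eq0 eq_le normc_ge0 andbT.
  apply/ler_addgt0Pr => e e0; rewrite add0r.
  have M1 : 0 < `|M| + 1 by rewrite ltr_wpDl.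
  have [k /(_ k (leqnn _))] := ux _ (divr_gt0 e0 M1).
  rewrite -hnormN opprB => uk.
  rewrite -(uP k).1 -fB; apply: le_trans (fM _) _.
  have := hnorm_ge0 (x - u k); have := ler_norm M; have := normr_ge0 M.
  move: uk; rewrite ltr_pdivlMr//; nra.
have xd : hnorm x <= d.
  suff : forall e : R, 0 < e -> hnorm x <= d + e by move=> ?; apply/ler_addgt0Pr.
  move=> e e0; have e20 : 0 < e / 2 by lra.
  have [k uk] := ux _ e20.
  have [n [kn nk]] : exists n : nat, (k <= n)%N /\ n.+1%:R^-1 < e / 2.
    exists (maxn k (Num.truncn (e / 2)^-1)); rewrite leq_maxl; split=> //.
    rewrite -[ltRHS]invrK ltf_pV2 ?posrE ?invr_gt0//.
    apply: (lt_le_trans (truncnS_gt _)); rewrite ler_nat ltnS; exact: leq_maxr.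
  have := uk _ kn; have := (uP n).2.
  rewrite -(hnormN (_ - _)) opprB; have := hnormB_ge x (u n).
  move: nk; move: (n.+1%:R^-1 : R) => v; lra.
have xmin y : f y = 1 -> hnorm x <= hnorm y by move=> fy; apply: le_trans xd (dle _ fy).
have x0' : x != 0 by apply/eqP => x_0; move: fx; rewrite x_0 f0 => /eqP; rewrite eq_sym oner_eq0.
have ort z : f z = 0 -> dotp x z = 0.
  move=> fz; have [->|z0] := eqVneq z 0; first by rewrite dotp0r.
  have := xmin (x - (dotp x z / (hnorm z ^+ 2)%:C) *: z).
  rewrite fB fZ fz mulr0 subr0 => /(_ fx).
  rewrite -(@ler_pXn2r _ 2) ?nnegrE ?hnorm_ge0// hnorm_opp_proj// => h.
  have zp : 0 < hnorm z ^+ 2 by rewrite exprn_gt0// lt_neqAle eq_sym hnorm_eq0 z0 hnorm_ge0.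
  have : normc (dotp x z) ^+ 2 / hnorm z ^+ 2 <= 0 by lra.
  rewrite ler_pdivrMr// mul0r => {}h.
  have : normc (dotp x z) == 0 by rewrite -sqrf_eq0 eq_le h sqr_ge0.
  by rewrite normc_eq0 => /eqP.
exists ((dotp x x)^-1 *: x) => v.
have xx : dotp x x != 0 by rewrite dotpxx expf_eq0 /= normr_eq0.
have : dotp x (v - f v *: x) = 0 by apply: ort; rewrite fB fZ fx mulr1 subrr.
rewrite dotpBr dotpZr => /eqP; rewrite subr_eq0 => /eqP h.
rewrite dotpZr fmorphV /= -dotpC (dotpC v) h rmorphM /= conjCK -dotpC.
by rewrite mulrCA mulVf// mulr1.
Qed.

End Riesz.
End HilbertTheory.

Record bop (R : realType) (H : hilbertType R) := Bop {
  bop_fun :> H -> H;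
  bop_linear : linear bop_fun;
  bop_bounded : exists M : R, forall x, hnorm (bop_fun x) <= M * hnorm x }.

Section BoundedOperators.
Context {R : realType} {H : hilbertType R}.
Implicit Types (S T : bop H) (x y z : H) (k : R[i]).

HB.instance Definition _ := gen_eqMixin (bop H).
HB.instance Definition _ := gen_choiceMixin (bop H).

Lemma bopP S T : (forall x, S x = T x) -> S = T.
Proof.
case: S T => [S SL SM] [T TL TM] /= /funext ST; subst T.
by congr Bop; exact: Prop_irrelevance.
Qed.

Lemma bopD T x y : T (x + y) = T x + T y.
Proof. by have := bop_linear T 1 x y; rewrite !scale1r. Qed.
Lemma bop0 T : T 0 = 0.
Proof. by apply: (addrI (T 0)); rewrite -bopD !addr0. Qed.
Lemma bopZ T k x : T (k *: x) = k *: T x.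
Proof. by have := bop_linear T k x 0; rewrite bop0 !addr0. Qed.
Lemma bopB T x y : T (x - y) = T x - T y.
Proof. by rewrite bopD -scaleN1r bopZ scaleN1r. Qed.

Lemma bop_bounded_ge0 T :
  exists2 M : R, 0 <= M & forall x, hnorm (T x) <= M * hnorm x.
Proof.
have [M MP] := bop_bounded T; exists `|M| => // x.
by apply: le_trans (MP x) _; rewrite ler_wpM2r ?hnorm_ge0// ler_norm.
Qed.

Fact bop_zero_linear : linear (fun _ : H => 0 : H).
Proof. by move=> k x y; rewrite scaler0 addr0. Qed.
Fact bop_zero_bounded : exists M : R, forall x, hnorm (0 : H) <= M * hnorm x.
Proof. by exists 0 => x; rewrite hnorm0 mul0r. Qed.
Definition bop_zero := Bop bop_zero_linear bop_zero_bounded.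

Fact bop_add_linear S T : linear (fun x => S x + T x).
Proof. by move=> k x y; rewrite !bopD !bopZ scalerDr addrACA. Qed.
Fact bop_add_bounded S T :
  exists M : R, forall x, hnorm (S x + T x) <= M * hnorm x.
Proof.
have [M MP] := bop_bounded S; have [N NP] := bop_bounded T; exists (M + N) => x.
by rewrite mulrDl; apply: le_trans (hnormD _ _) _; exact: lerD.
Qed.
Definition bop_add S T := Bop (bop_add_linear S T) (bop_add_bounded S T).

Fact bop_opp_linear T : linear (fun x => - T x).
Proof. by move=> k x y; rewrite bopD bopZ opprD scalerN. Qed.
Fact bop_opp_bounded T : exists M : R, forall x, hnorm (- T x) <= M * hnorm x.
Proof. by have [M MP] := bop_bounded T; exists M => x; rewrite hnormN. Qed.
Definition bop_opp T := Bop (bop_opp_linear T) (bop_opp_bounded T).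

Fact bop_scale_linear k T : linear (fun x => k *: T x).
Proof. by move=> l x y; rewrite bopD bopZ scalerDr !scalerA mulrC. Qed.
Fact bop_scale_bounded k T :
  exists M : R, forall x, hnorm (k *: T x) <= M * hnorm x.
Proof.
have [M MP] := bop_bounded T; exists (normc k * M) => x.
by rewrite hnormZ -mulrA ler_wpM2l// normc_ge0.
Qed.
Definition bop_scale k T := Bop (bop_scale_linear k T) (bop_scale_bounded k T).

Fact bop_one_linear : linear (@id H). Proof. by []. Qed.
Fact bop_one_bounded : exists M : R, forall x : H, hnorm (id x) <= M * hnorm x.
Proof. by exists 1 => x; rewrite mul1r. Qed.
Definition bop_one := Bop bop_one_linear bop_one_bounded.

Fact bop_mul_linear S T : linear (S \o T).
Proof. by move=> k x y /=; rewrite !(bopD, bopZ). Qed.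
Fact bop_mul_bounded S T :
  exists M : R, forall x, hnorm ((S \o T) x) <= M * hnorm x.
Proof.
have [M M0 MP] := bop_bounded_ge0 S; have [N NP] := bop_bounded T.
exists (M * N) => x; apply: le_trans (MP _) _.
by rewrite -mulrA ler_wpM2l.
Qed.
Definition bop_mul S T := Bop (bop_mul_linear S T) (bop_mul_bounded S T).

Fact bop_addA : associative bop_add.
Proof. by move=> S T U; apply: bopP => x /=; rewrite addrA. Qed.
Fact bop_addC : commutative bop_add.
Proof. by move=> S T; apply: bopP => x /=; rewrite addrC. Qed.
Fact bop_add0 : left_id bop_zero bop_add.
Proof. by move=> T; apply: bopP => x /=; rewrite add0r. Qed.
Fact bop_addN : left_inverse bop_zero bop_opp bop_add.
Proof. by move=> T; apply: bopP => x /=; rewrite addNr. Qed.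
HB.instance Definition _ :=
  GRing.isZmodule.Build (bop H) bop_addA bop_addC bop_add0 bop_addN.

Fact bop_mulA : associative bop_mul.
Proof. by move=> S T U; apply: bopP. Qed.
Fact bop_mul1 : left_id bop_one bop_mul.
Proof. by move=> T; apply: bopP. Qed.
Fact bop_mulr1 : right_id bop_one bop_mul.
Proof. by move=> T; apply: bopP. Qed.
Fact bop_mulDl : left_distributive bop_mul +%R.
Proof. by move=> S T U; apply: bopP. Qed.
Fact bop_mulDr : right_distributive bop_mul +%R.
Proof. by move=> S T U; apply: bopP => x /=; rewrite bopD. Qed.
Fact bop_one_neq0 : bop_one != 0.
Proof.
have [x x0] := hilbert_neq0 (s := H); apply: contra x0 => /eqP h.
by have /= -> := congr1 (fun T : bop H => T x) h.
Qed.
HB.instance Definition _ := GRing.Zmodule_isNzRing.Build (bop H)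
  bop_mulA bop_mul1 bop_mulr1 bop_mulDl bop_mulDr bop_one_neq0.

Fact bop_scaleA k l T : bop_scale k (bop_scale l T) = bop_scale (k * l) T.
Proof. by apply: bopP => x /=; rewrite scalerA. Qed.
Fact bop_scale1 : left_id 1 bop_scale.
Proof. by move=> T; apply: bopP => x /=; rewrite scale1r. Qed.
Fact bop_scaleDr : right_distributive bop_scale +%R.
Proof. by move=> k S T; apply: bopP => x /=; rewrite scalerDr. Qed.
Fact bop_scaleDl T : {morph bop_scale^~ T : k l / k + l}.
Proof. by move=> k l; apply: bopP => x /=; rewrite scalerDl. Qed.
HB.instance Definition _ := GRing.Zmodule_isLmodule.Build R[i] (bop H)
  bop_scaleA bop_scale1 bop_scaleDr bop_scaleDl.

Fact bop_scaleAl k S T : k *: (S * T) = k *: S * T.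
Proof. by apply: bopP. Qed.
HB.instance Definition _ :=
  GRing.Lmodule_isLalgebra.Build R[i] (bop H) bop_scaleAl.
Fact bop_scaleAr k S T : k *: (S * T) = S * (k *: T).
Proof. by apply: bopP => x /=; rewrite bopZ. Qed.
HB.instance Definition _ :=
  GRing.Lalgebra_isAlgebra.Build R[i] (bop H) bop_scaleAr.

Lemma bop_addE S T x : (S + T) x = S x + T x. Proof. by []. Qed.
Lemma bop_scaleE k T x : (k *: T) x = k *: T x. Proof. by []. Qed.
Lemma bop_mulE S T x : (S * T) x = S (T x). Proof. by []. Qed.
Lemma bop_subE S T x : (S - T) x = S x - T x. Proof. by []. Qed.

Lemma bop_adjoint_ex T : exists S, forall x y, dotp (T x) y = dotp x (S y).
Proof.
have [M M0 MP] := bop_bounded_ge0 T.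
have /choice[g gP] : forall y, exists z, forall x, dotp (T x) y = dotp x z.
  move=> y; apply: (@riesz _ _ _ (M * hnorm y)) => [k x z|x].
    by rewrite bopD bopZ dotp_linear.
  apply: le_trans (hnorm_cauchy_schwarz _ _) _.
  by rewrite mulrAC ler_wpM2r ?hnorm_ge0.
have gL : linear g.
  move=> k x y; apply: dotp_inj => z.
  by rewrite -gP !dotpDr !dotpZr -!gP.
have gM : exists M : R, forall x, hnorm (g x) <= M * hnorm x.
  exists M => x; have [->|gx] := eqVneq (hnorm (g x)) 0.
    by rewrite mulr_ge0// hnorm_ge0.
  have g0 : 0 < hnorm (g x) by rewrite lt_neqAle eq_sym gx hnorm_ge0.
  rewrite -(ler_pM2l g0) -expr2 -lecR hnorm_sqr -gP mulrA (mulrC _ M).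
  have rE : (normc (dotp (T (g x)) x))%:C = dotp (T (g x)) x.
    by rewrite normC_normc ger0_norm// gP -hnorm_sqr ler0c sqr_ge0.
  rewrite -rE lecR; apply: le_trans (hnorm_cauchy_schwarz _ _) _.
  by rewrite ler_wpM2r ?hnorm_ge0.
by exists (Bop gL gM).
Qed.

(* The adjoint operator, obtained from Riesz representation. *)
Definition adj T : bop H := projT1 (cid (bop_adjoint_ex T)).

Lemma adjP T x y : dotp (T x) y = dotp x (adj T y).
Proof. by rewrite /adj; case: cid. Qed.
Lemma adjPl T x y : dotp (adj T x) y = dotp x (T y).
Proof. by rewrite dotpC -adjP -dotpC. Qed.

Fact adj_semilinear k S T : adj (k *: S + T) = Num.conj k *: adj S + adj T.
Proof.
apply: bopP => y; apply: dotp_inj => x.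
by rewrite -adjP !(bop_addE, bop_scaleE) dotpDl dotpDr dotpZl dotpZr conjCK -!adjP.
Qed.
Fact adjM S T : adj (S * T) = adj T * adj S.
Proof.
by apply: bopP => y; apply: dotp_inj => x; rewrite -adjP !bop_mulE -!adjP.
Qed.
Fact adjK T : adj (adj T) = T.
Proof. by apply: bopP => y; apply: dotp_inj => x; rewrite -adjP adjPl. Qed.
HB.instance Definition _ :=
  isStarAlgebra.Build R (bop H) adj_semilinear adjM adjK.

Definition opnorm T : R := sup [set hnorm (T x) | x in [set x | hnorm x <= 1]].

Lemma opnorm_has_sup T :
  has_sup [set hnorm (T x) | x in [set x | hnorm x <= 1]].
Proof.
split; first by exists (hnorm (T 0)); exists 0; rewrite //= hnorm0.
have [M M0 MP] := bop_bounded_ge0 T; exists M => _ [x /= x1 <-].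
by apply: le_trans (MP x) _; rewrite ler_piMr.
Qed.

Lemma opnorm_ge0 T : 0 <= opnorm T.
Proof.
apply: (@le_trans _ _ (hnorm (T 0))); first exact: hnorm_ge0.
by apply: (sup_upper_bound (opnorm_has_sup T)); exists 0; rewrite //= hnorm0.
Qed.

Lemma opnorm_bound T x : hnorm (T x) <= opnorm T * hnorm x.
Proof.
have [->|x0] := eqVneq x 0; first by rewrite bop0 hnorm0 mulr0.
have xp : 0 < hnorm x by rewrite lt_neqAle eq_sym hnorm_eq0 x0 hnorm_ge0.
have nE : normc (hnorm x)^-1%:C = (hnorm x)^-1.
  by rewrite normc_real ger0_norm// invr_ge0 ltW.
rewrite -ler_pdivrMr// mulrC -nE -hnormZ -bopZ.
apply: (sup_upper_bound (opnorm_has_sup T)).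
by exists ((hnorm x)^-1%:C *: x) => //=; rewrite hnormZ nE mulVf ?gt_eqF.
Qed.

Lemma opnorm_le T (M : R) : 0 <= M ->
  (forall x, hnorm (T x) <= M * hnorm x) -> opnorm T <= M.
Proof.
move=> M0 MP; apply: ge_sup; first exact: (opnorm_has_sup T).1.
by move=> _ [x /= x1 <-]; apply: le_trans (MP x) _; rewrite ler_piMr.
Qed.

Fact opnorm_eq0 T : opnorm T = 0 -> T = 0.
Proof.
move=> T0; apply: bopP => x; apply/eqP; rewrite -hnorm_eq0 eq_le hnorm_ge0 andbT.
by have := opnorm_bound T x; rewrite T0 mul0r.
Qed.
Fact opnormD S T : opnorm (S + T) <= opnorm S + opnorm T.
Proof.
apply: opnorm_le => [|x]; first by rewrite addr_ge0 ?opnorm_ge0.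
rewrite mulrDl; apply: le_trans (hnormD _ _) _.
by rewrite lerD ?opnorm_bound.
Qed.
Let opnormZ_le k T : opnorm (k *: T) <= normc k * opnorm T.
Proof.
apply: opnorm_le => [|x]; first by rewrite mulr_ge0 ?opnorm_ge0 ?normc_ge0.
by rewrite hnormZ -mulrA ler_wpM2l ?normc_ge0 ?opnorm_bound.
Qed.
Fact opnormZ k T : opnorm (k *: T) = normc k * opnorm T.
Proof.
apply/eqP; rewrite eq_le opnormZ_le /=; have [->|k0] := eqVneq k 0.
  by rewrite normc0 mul0r opnorm_ge0.
have kp : 0 < normc k by rewrite lt_neqAle eq_sym normc_eq0 k0 normc_ge0.
rewrite -ler_pdivlMl// -normcV -[X in opnorm X <= _](scale1r T).
by rewrite -(mulVf k0) -scalerA; exact: opnormZ_le.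
Qed.
Fact opnormM S T : opnorm (S * T) <= opnorm S * opnorm T.
Proof.
apply: opnorm_le => [|x]; first by rewrite mulr_ge0 ?opnorm_ge0.
rewrite bop_mulE; apply: le_trans (opnorm_bound _ _) _.
by rewrite -mulrA ler_wpM2l ?opnorm_ge0 ?opnorm_bound.
Qed.
Let opnorm_adj_le T : opnorm (adj T) <= opnorm T.
Proof.
apply: opnorm_le => [|x]; first exact: opnorm_ge0.
have [->|gx] := eqVneq (hnorm (adj T x)) 0.
  by rewrite mulr_ge0 ?opnorm_ge0 ?hnorm_ge0.
have g0 : 0 < hnorm (adj T x) by rewrite lt_neqAle eq_sym gx hnorm_ge0.
have := hnorm_cauchy_schwarz (T (adj T x)) x.
rewrite adjP -hnorm_sqr normc_real ger0_norm ?sqr_ge0//.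
have := opnorm_bound T (adj T x).
move=> /(ler_wpM2r (hnorm_ge0 x)) h1 /le_trans /(_ h1).
by rewrite expr2 mulrAC ler_pM2r.
Qed.
Fact opnorm_star T : opnorm (star T * T) = opnorm T ^+ 2.
Proof.
apply/eqP; rewrite eq_le; apply/andP; split.
  apply: le_trans (opnormM _ _) _.
  by rewrite expr2 ler_wpM2r ?opnorm_ge0 ?opnorm_adj_le.
set N := opnorm (star T * T); have N0 : 0 <= N := opnorm_ge0 _.
rewrite -(sqr_sqrtr N0) ler_sqr ?nnegrE ?opnorm_ge0 ?sqrtr_ge0//.
apply: opnorm_le => [|x]; first exact: sqrtr_ge0.
rewrite -ler_sqr ?nnegrE ?mulr_ge0 ?hnorm_ge0 ?sqrtr_ge0//.
rewrite exprMn sqr_sqrtr// expr2.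
have := hnorm_cauchy_schwarz ((star T * T) x) x.
rewrite [in dotp _ _]bop_mulE [star T]/(adj T) adjPl -hnorm_sqr normc_real ger0_norm ?sqr_ge0//.
rewrite expr2 => /le_trans; apply; rewrite expr2 mulrA.
by rewrite ler_wpM2r ?hnorm_ge0//; exact: (opnorm_bound (star T * T) x).
Qed.

Fact bop_complete (u : nat -> bop H) :
  cauchy_for opnorm u -> exists l, cvg_for opnorm u l.
Proof.
move=> cu.
have cux x : cauchy_for hnorm (fun n => u n x).
  move=> e e0; have xp : 0 < hnorm x + 1 by rewrite ltr_wpDl ?hnorm_ge0.
  have [k uk] := cu _ (divr_gt0 e0 xp); exists k => m n km kn.
  have := uk _ _ km kn; rewrite ltr_pdivlMr// => h.
  have := opnorm_bound (u m - u n) x; rewrite bop_subE => h1.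
  by have := opnorm_ge0 (u m - u n); lra.
have /choice[g gP] : forall x, exists l, cvg_for hnorm (fun n => u n x) l.
  by move=> x; exact: hilbert_complete.
have gD (e : R) : 0 < e -> exists k : nat, forall n x, (k <= n)%N ->
    hnorm (u n x - g x) <= e * hnorm x.
  move=> e0; have [k uk] := cu _ e0; exists k => n x kn.
  suff : forall d : R, 0 < d -> hnorm (u n x - g x) <= e * hnorm x + d.
    by move=> ?; apply/ler_addgt0Pr.
  move=> d d0; have [j uj] := gP x _ d0.
  have := uj _ (leq_maxl j k); have := uk _ _ kn (leq_maxr j k).
  set i := maxn j k => uni uix.
  have -> : u n x - g x = (u n x - u i x) + (u i x - g x) by rewrite addrA subrK.
  apply: le_trans (hnormD _ _) _; apply: lerD; last exact: ltW.
  apply: le_trans (opnorm_bound (u n - u i) x) _.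
  by rewrite ler_wpM2r ?hnorm_ge0// ltW.
have gE x y : (forall e : R, 0 < e -> hnorm (x - y) <= e) -> x = y :> H.
  move=> h; apply/eqP; rewrite -subr_eq0 -hnorm_eq0 eq_le hnorm_ge0 andbT.
  by apply/ler_addgt0Pr => e e0; rewrite add0r; exact: h.
have gL : linear g.
  move=> k x y; apply: gE => e e0.
  pose c := hnorm (k *: x + y) + (normc k * hnorm x + hnorm y) + 1.
  have nk := normc_ge0 k; have nx := hnorm_ge0 x; have ny := hnorm_ge0 y.
  have nkx := hnorm_ge0 (k *: x + y).
  have c0 : 0 < c by rewrite /c ltr_wpDl// !addr_ge0// mulr_ge0.
  have [i ui] := gD _ (divr_gt0 e0 c0).
  have h1 := ui i (k *: x + y) (leqnn _).
  have h2 := ui i x (leqnn _); have h3 := ui i y (leqnn _).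
  have -> : g (k *: x + y) - (k *: g x + g y) =
    - (u i (k *: x + y) - g (k *: x + y)) +
    (k *: (u i x - g x) + (u i y - g y)).
    rewrite bopD bopZ scalerBr opprB [X in _ = _ + X]addrACA -opprD.
    by rewrite addrA subrK.
  apply: le_trans (hnormD _ _) _; rewrite hnormN.
  have h4 := hnormD (k *: (u i x - g x)) (u i y - g y).
  rewrite hnormZ in h4.
  have h5 := ler_wpM2l nk h2.
  have ec : e / c * c = e by rewrite mulfVK ?gt_eqF.
  move: ec; rewrite {2}/c !mulrDr mulr1 => ec.
  have e1 : 0 <= e / c by rewrite divr_ge0 ?ltW.
  lra.
have gM : exists M : R, forall x, hnorm (g x) <= M * hnorm x.
  have [i ui] := gD _ ltr01; exists (opnorm (u i) + 1) => x.
  have h1 := opnorm_bound (u i) x; have h2 := ui i x (leqnn _).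
  have := hnormB_ge (g x) (u i x); rewrite -(hnormN (_ - _)) opprB; lra.
exists (Bop gL gM) => e e0; have e20 : 0 < e / 2 by lra.
have [k uk] := gD _ e20; exists k => n kn.
apply: (@le_lt_trans _ _ (e / 2)); last lra.
by apply: opnorm_le => [|x]; [exact: ltW | exact: uk].
Qed.

HB.instance Definition _ := isCStarAlgebra.Build R (bop H)
  opnorm_eq0 opnormD opnormZ opnormM opnorm_star bop_complete.

Fact theta_linear (x y : H) : linear (fun z => dotp z y *: x).
Proof. by move=> k z t; rewrite dotp_linear scalerDl scalerA. Qed.
Fact theta_bounded (x y : H) :
  exists M : R, forall z, hnorm (dotp z y *: x) <= M * hnorm z.
Proof.
exists (hnorm y * hnorm x) => z; rewrite hnormZ mulrAC.
by rewrite ler_wpM2r ?hnorm_ge0// (mulrC (hnorm y)) hnorm_cauchy_schwarz.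
Qed.
(* theta x y z = <z, y> x *)
Definition theta (x y : H) : bop H := Bop (theta_linear x y) (theta_bounded x y).

End BoundedOperators.

Definition cstar_subalgebra (R : realType) (B : cstarType R) (D : set B) :=
  [/\ D 1,
      forall (k : R[i]) a b, D a -> D b -> D (k *: a + b),
      forall a b, D a -> D b -> D (a * b),
      forall a, D a -> D (star a) &
      forall (u : nat -> B) l, (forall n, D (u n)) -> cvg_for cnorm u l -> D l].

(* The C*-subalgebra C*(G) of B generated by G and 1. *)
Section GeneratedCStarAlgebra.
Context {R : realType} {B : cstarType R}.
Variable G : set B.

Definition cstar_gen_pred : {pred B} :=
  [pred a | a \in smallest (@cstar_subalgebra R B) G].

Record cstar_gen := CStarGen {
  cstar_val :> B;
  cstar_valP : cstar_val \in cstar_gen_pred }.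

HB.instance Definition _ := [isSub for cstar_val].
HB.instance Definition _ := [Choice of cstar_gen by <:].

Lemma cstar_gen_subalgebra : cstar_subalgebra (smallest (@cstar_subalgebra R B) G).
Proof.
split=> [D [[]]//|k a b Da Db D DG|a b Da Db D DG|a Da D DG|u l Du ul D DG];
  have [[D1 Dlin Dmul Dstar Dlim] GD] := DG.
- by apply: Dlin; [exact: Da | exact: Db].
- by apply: Dmul; [exact: Da | exact: Db].
- by apply: Dstar; exact: Da.
- by apply: Dlim ul => n; exact: Du.
Qed.

Lemma cstar_gen_predP a :
  (a \in cstar_gen_pred) <-> smallest (@cstar_subalgebra R B) G a.
Proof. by split=> [/set_mem|/mem_set]. Qed.

Lemma cstar_gen_incl a : G a -> a \in cstar_gen_pred.
Proof. by move=> Ga; apply/cstar_gen_predP => D [_]; exact. Qed.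

Fact cstar_gen_subalg : subalg_closed cstar_gen_pred.
Proof.
have [D1 Dlin Dmul _ _] := cstar_gen_subalgebra.
split=> [|k a b|a b]; first exact/cstar_gen_predP.
  by move=> /cstar_gen_predP Da /cstar_gen_predP Db; apply/cstar_gen_predP; exact: Dlin.
by move=> /cstar_gen_predP Da /cstar_gen_predP Db; apply/cstar_gen_predP; exact: Dmul.
Qed.
HB.instance Definition _ :=
  GRing.isSubalgClosed.Build R[i] B cstar_gen_pred cstar_gen_subalg.
HB.instance Definition _ := [SubChoice_isSubAlgebra of cstar_gen by <:].

Lemma cstar_val_gen (a : cstar_gen) : smallest (@cstar_subalgebra R B) G (cstar_val a).
Proof. exact/cstar_gen_predP/cstar_valP. Qed.

Fact cstar_gen_star_subproof (a : cstar_gen) :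
  star (cstar_val a) \in cstar_gen_pred.
Proof.
apply/cstar_gen_predP; have [_ _ _ Dstar _] := cstar_gen_subalgebra.
by apply: Dstar; exact: cstar_val_gen.
Qed.
Definition cstar_gen_star a := CStarGen (cstar_gen_star_subproof a).

Fact cstar_gen_star_semilinear (k : R[i]) (a b : cstar_gen) :
  cstar_gen_star (k *: a + b) =
  Num.conj k *: cstar_gen_star a + cstar_gen_star b.
Proof. by apply: val_inj; rewrite /= star_semilinear. Qed.
Fact cstar_gen_starM (a b : cstar_gen) :
  cstar_gen_star (a * b) = cstar_gen_star b * cstar_gen_star a.
Proof. by apply: val_inj; rewrite /= starM. Qed.
Fact cstar_gen_starK (a : cstar_gen) : cstar_gen_star (cstar_gen_star a) = a.
Proof. by apply: val_inj; rewrite /= starK. Qed.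
HB.instance Definition _ := isStarAlgebra.Build R cstar_gen
  cstar_gen_star_semilinear cstar_gen_starM cstar_gen_starK.

Definition cstar_gen_norm (a : cstar_gen) : R := cnorm (cstar_val a).
Fact cstar_gen_norm_eq0 a : cstar_gen_norm a = 0 -> a = 0.
Proof. by move=> /cnorm_eq0 a0; apply: val_inj. Qed.
Fact cstar_gen_normD a b :
  cstar_gen_norm (a + b) <= cstar_gen_norm a + cstar_gen_norm b.
Proof. exact: cnormD. Qed.
Fact cstar_gen_normZ k a : cstar_gen_norm (k *: a) = normc k * cstar_gen_norm a.
Proof. exact: cnormZ. Qed.
Fact cstar_gen_normM a b :
  cstar_gen_norm (a * b) <= cstar_gen_norm a * cstar_gen_norm b.
Proof. exact: cnormM. Qed.
Fact cstar_gen_norm_star a :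
  cstar_gen_norm (star a * a) = cstar_gen_norm a ^+ 2.
Proof. exact: cnorm_star. Qed.
Fact cstar_gen_complete (u : nat -> cstar_gen) :
  cauchy_for cstar_gen_norm u -> exists l, cvg_for cstar_gen_norm u l.
Proof.
move=> cu; have [l ul] := cstar_complete (fun n => cstar_val (u n)) cu.
have [_ _ _ _ Dlim] := cstar_gen_subalgebra.
have lP : l \in cstar_gen_pred.
  apply/cstar_gen_predP; apply: Dlim ul => n; exact: cstar_val_gen.
by exists (CStarGen lP).
Qed.
HB.instance Definition _ := isCStarAlgebra.Build R cstar_gen
  cstar_gen_norm_eq0 cstar_gen_normD cstar_gen_normZ cstar_gen_normM
  cstar_gen_norm_star cstar_gen_complete.

End GeneratedCStarAlgebra.

Section StatesAndMorphisms.
Context {R : realType}.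

Definition is_state (A : starAlgType R) (om : A -> R[i]) :=
  [/\ scalar om, forall a, 0 <= om (star a * a) & om 1 = 1].

Definition faithful (A : starAlgType R) (om : A -> R[i]) :=
  forall a, om (star a * a) = 0 -> a = 0.

Definition tracial (A : starAlgType R) (om : A -> R[i]) :=
  forall a b, om (a * b) = om (b * a).

(* Pure states are the extreme points of the state space. *)
Definition pure_state (A : starAlgType R) (phi : A -> R[i]) :=
  is_state phi /\
  forall (om1 om2 : A -> R[i]) (t : R[i]), is_state om1 -> is_state om2 ->
    0 < t < 1 -> (forall a, phi a = t * om1 a + (1 - t) * om2 a) ->
    om1 = phi /\ om2 = phi.

(* Unital *-homomorphisms. *)
Definition star_hom (A B : starAlgType R) (f : A -> B) :=
  [/\ linear f, f 1 = 1, forall a b, f (a * b) = f a * f b &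
      forall a, f (star a) = star (f a)].

Definition star_automorphism (A : starAlgType R) (f : A -> A) :=
  star_hom f /\ bijective f.

Definition unitary (A : starAlgType R) (u : A) :=
  star u * u = 1 /\ u * star u = 1.

Definition asymptotically_inner (A : cstarType R) (alpha : A -> A) :=
  exists u : R -> A,
  [/\ forall t, 0 <= t -> unitary (u t),
      u 0 = 1,
      forall t, 0 <= t ->
        cnorm (u s - u t) @[s --> within [set s | 0 <= s] (nbhs t)] --> (0 : R) &
      forall a, cnorm (alpha a - u t * a * star (u t)) @[t --> +oo] --> (0 : R)].

End StatesAndMorphisms.

Section Representations.
Context {R : realType}.

Definition closed_subspace (H : hilbertType R) (M : set H) :=
  [/\ closed M, M 0 & forall (k : R[i]) x y, M x -> M y -> M (k *: x + y)].

(* A representation of A on H is a unital *-homomorphism A -> bop H. *)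
Definition irreducible_rep (A : starAlgType R) (H : hilbertType R)
    (pi : A -> bop H) :=
  star_hom pi /\
  forall M : set H, closed_subspace M -> (forall a x, M x -> M (pi a x)) ->
    M = [set 0] \/ M = setT.

Definition unitarily_equivalent (A : starAlgType R) (H K : hilbertType R)
    (pi : A -> bop H) (rho : A -> bop K) :=
  exists U : H -> K,
  [/\ linear U, forall x y, dotp (U x) (U y) = dotp x y, set_surj setT setT U &
      forall a x, U (pi a x) = rho a (U x)].

Definition GNS_triple (A : starAlgType R) (phi : A -> R[i])
    (H : hilbertType R) (pi : A -> bop H) (xi : H) :=
  [/\ star_hom pi, closure (range (fun a => pi a xi)) = setT &
      forall a, phi a = dotp (pi a xi) xi].

(* Exactly one representative of each unitary equivalence class of
   irreducible representations. *)
Definition irreducible_representatives (A : starAlgType R) (I : Type)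
    (HI : I -> hilbertType R) (pi : forall i, A -> bop (HI i)) :=
  (forall i, irreducible_rep (pi i)) /\
  forall (K : hilbertType R) (rho : A -> bop K), irreducible_rep rho ->
    exists! i, unitarily_equivalent (pi i) rho.

(* H is the Hilbert space direct sum of the HI i, with coordinate inclusions
   V i: isometric, mutually orthogonal, and with dense linear span. *)
Definition hilbert_direct_sum (I : Type) (HI : I -> hilbertType R)
    (H : hilbertType R) (V : forall i, HI i -> H) :=
  [/\ forall i, linear (V i),
      forall i x y, dotp (V i x) (V i y) = dotp x y,
      forall i j x y, i <> j -> dotp (V i x) (V j y) = 0 &
      forall M : set H, closed_subspace M -> (forall i x, M (V i x)) -> M = setT].

End Representations.

Section CARAlgebra.
Context {R : realType}.

(* The dimension 2 ^ n of the n-th tensor power of the plane, defined so that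
   A *t B : 'M_(qdim n.+1) for A : 'M_(qdim n) and B : 'M_2 without a cast. *)
Fixpoint qdim n := if n is m.+1 then (qdim m * 2)%N else 1%N.

Definition tens2 n (a : 'M[R[i]]_(qdim n)) (b : 'M[R[i]]_2) :
  'M[R[i]]_(qdim n.+1) := a *t b.

(* iota n embeds the matrix algebra C_n = 'M_2 ^ (tensor n) into C compatibly
   with a |-> a (x) 1, and C is the norm closure of the union of the images. *)
Definition CAR_algebra (C : cstarType R)
    (iota : forall n, 'M[R[i]]_(qdim n) -> C) :=
  [/\ forall n, [/\ linear (iota n), iota n 1%:M = 1,
        forall a b, iota n (a *m b) = iota n a * iota n b,
        forall a, iota n (map_mx Num.conj a^T) = star (iota n a) &
        injective (iota n)],
      forall n a, iota n.+1 (tens2 a 1%:M) = iota n a &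
      forall (c : C) (e : R), 0 < e -> exists n a, cnorm (c - iota n a) < e].

Variables (C : cstarType R) (iota : forall n, 'M[R[i]]_(qdim n) -> C).

Definition normalized_trace (tau : C -> R[i]) :=
  is_state tau /\ forall n (a : 'M_(qdim n)), tau (iota a) = \tr a / 2 ^+ n.

(* The product of the vector states b |-> b 0 0 of 'M_2. *)
Definition product_state (phi : C -> R[i]) :=
  is_state phi /\
  forall n (a : 'M_(qdim n)) (b : 'M_2),
    phi (iota (tens2 a b)) = phi (iota a) * b 0 0.

Fixpoint e00_tens n : 'M[R[i]]_(qdim n) :=
  if n is m.+1 then tens2 (e00_tens m) (delta_mx 0 0) else 1%:M.

Definition qproj n : C := iota (e00_tens n).
Definition fproj n : C := qproj n - qproj n.+1.
Definition pproj (alpha : C -> C) n : C := alpha (qproj n).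
Definition eproj (alpha : C -> C) n : C := pproj alpha n - pproj alpha n.+1.

End CARAlgebra.

Section TheAlgebra.
Context {R : realType} {C : cstarType R} {H : hilbertType R} {I : Type}.
Variables (Pi : C -> bop H) (L : I -> bop H).

Definition algA : cstarType R := cstar_gen (range Pi `|` range L).

Definition algA_incl (a : C) : algA :=
  CStarGen (cstar_gen_incl (or_introl (imageT Pi a))).

End TheAlgebra.

(* Main.v *)
Require Import Defs.
From mathcomp Require Import all_boot all_order all_algebra complex ring lra mxtens.
From mathcomp Require Import all_classical all_reals topology normedtype.
From mathcomp Require Import sequences.
Import Order.TTheory GRing.Theory Num.Theory.
Import numFieldNormedType.Exports.
Import Normc Defs.
Local Open Scope classical_set_scope.
Local Open Scope complex_scope.
Local Open Scope ring_scope.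

Set Implicit Arguments.
Unset Strict Implicit.
Unset Printing Implicit Defensive.

(** The C*-algebra A is generated by a copy j(C) of the CAR algebra and unitaries
    L i, and each L i differs from an element of C by a term that is small for
    the trace: with s i N the partial sums of the w i n,
      L i - j(s i N) = L i j(p i N) = j(q N) L i,
    where p i N and q N are projections of trace 2^-N.

    Uniqueness and existence. Let om be a state of A that extends the trace tau.
    For the seminorm om(a^* a)^(1/2), left multiplications are bounded and
    L i j(p i N) j(c) is small, as tau is tracial on C. So j(C) is dense in A for
    this seminorm, with approximants that do not depend on om, and tau determines
    om. The same argument works for sequences of states that extend tau only in
    the limit, and then it also proves convergence ([approx_span_full],
    [approx_span_determined]). Such sequences exist: average a vector state over
    the matrix units of C_n. The averages commute with C_n, so their limit
    commutes with j(C), and by the displayed relation with the L i. Since the CAR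
    algebra has only one tracial state, A has only one as well.

    Faithfulness. The pure state phi r also has a unique extension to A, namely
    the vector state v at zeta r, and this too holds for sequences of states that
    extend phi r in the limit. Here the dense set is spanned by the products
    j(c) (L i)^*, which move zeta r into each of the summands H_i
    ([orbit_approx_span]); the projections p k N converge strongly to the
    projection onto zeta k, because a vector of an irreducible representation
    that is fixed by all of them has vector state phi k ([state_excision],
    [projection_limit_disjoint]). If t is the tracial extension of tau, the states
    2^n t(q_n x q_n) extend phi r in the limit, so they converge to v(x). They
    vanish at (a b)^* (a b) if t(a^* a) = 0; hence a b zeta r = 0 for all b in A,
    and a = 0 because zeta r is cyclic ([trace_extension_faithful]). *)


(** * Null sequences and complex limits *)

Section NullSequences.
Context {R : realType}.
Implicit Types (u v : nat -> R) (e k : R).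

(** One-sided, since it is applied to norms: a bound by a null sequence is then
    all that is needed to be null. *)
Definition null u := forall e, 0 < e -> \forall n \near \oo, u n <= e.

Lemma null_near u v : (\forall n \near \oo, u n <= v n) -> null v -> null u.
Proof.
move=> uv v0 e /v0 ve; near=> n.
by apply: (@le_trans _ _ (v n)); near: n.
Unshelve. all: by end_near. Qed.

Lemma null_le u v : (forall n, u n <= v n) -> null v -> null u.
Proof. by move=> uv; apply: null_near; near=> n. Unshelve. all: by end_near. Qed.

Lemma nullD u v : null u -> null v -> null (fun n => u n + v n).
Proof.
move=> u0 v0 e e0; have e2 : 0 < e / 2 by lra.
near=> n; have : u n <= e / 2 by near: n; exact: u0.
have : v n <= e / 2 by near: n; exact: v0.
by lra.
Unshelve. all: by end_near. Qed.

Lemma nullZ k u : 0 <= k -> null u -> null (fun n => k * u n).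
Proof.
move=> k0 u0 e e0; have k1 : 0 < k + 1 by rewrite ltr_wpDl.
near=> n; have : u n <= e / (k + 1) by near: n; apply: u0; rewrite divr_gt0.
rewrite ler_pdivlMr// mulrDr mulr1 => h.
have [un|un] := leP 0 (u n); first by rewrite mulrC; lra.
by apply: (@le_trans _ _ 0); [rewrite mulr_ge0_le0// ltW | exact: ltW].
Unshelve. all: by end_near. Qed.

Lemma null_sqrt u : null u -> null (fun n => Num.sqrt (u n)).
Proof.
move=> u0 e e0; near=> n; rewrite -[leRHS](ger0_norm (ltW e0)) -sqrtr_sqr; apply: ler_wsqrtr.
by near: n; apply: u0; rewrite exprn_gt0.
Unshelve. all: by end_near. Qed.

Lemma null_cst k : null (fun=> k) -> k <= 0.
Proof.
by move=> k0; apply/ler_addgt0Pr => e /k0 [n _ /(_ n (leqnn n))]; rewrite add0r.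
Qed.

Lemma null0 : null (fun=> 0).
Proof. by move=> e e0; near=> n; exact: ltW. Unshelve. all: by end_near. Qed.

Lemma null_comp (f : nat -> nat) u :
  (forall n, (n <= f n)%N) -> null u -> null (u \o f).
Proof.
move=> fn u0 e /u0 [k _ uk]; exists k => // n /= kn.
by apply: uk => /=; exact: leq_trans (fn n).
Qed.

Lemma null_expr k : 0 <= k < 1 -> null (fun n => k ^+ n).
Proof.
move=> /andP[k0 k1] e e0.
have : `|k| < 1 by rewrite ger0_norm.
move=> /cvg_expr /cvgr_le; apply; exact: e0.
Qed.

Lemma null_cvg_for (V : zmodType) (N : V -> R) (x : nat -> V) l :
  null (fun n => N (x n - l)) <-> cvg_for N x l.
Proof.
split=> [xl e e0|xl e /xl[k xk]]; last by exists k => // n /= /xk /ltW.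
have /xl [k _ xk] : 0 < e / 2 by lra.
by exists k => n /xk h; apply: le_lt_trans h _; lra.
Qed.

End NullSequences.

Section ComplexModulus.
Context {R : realType}.
Implicit Types z w : R[i].

Lemma normcD z w : normc (z + w) <= normc z + normc w.
Proof. exact: (@le_normcD R). Qed.
Lemma normc_opp z : normc (- z) = normc z.
Proof. exact: (@normcN R). Qed.
Lemma normc_distC z w : normc (z - w) = normc (w - z).
Proof. by rewrite -normc_opp opprB. Qed.
Lemma Re_le_normc z : complex.Re z <= normc z.
Proof.
case: z => a b /=; apply: le_trans (ler_norm a) _.
by rewrite -sqrtr_sqr ler_wsqrtr// lerDl sqr_ge0.
Qed.
Lemma normc_dist z w t : normc (z - w) <= normc (z - t) + normc (t - w).
Proof. by rewrite (_ : z - w = (z - t) + (t - w)) ?normcD// addrA subrK. Qed.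

Lemma normc_le0 z : normc z <= 0 -> z = 0.
Proof. by move=> h; apply/eqP; rewrite -normc_eq0 eq_le h normc_ge0. Qed.

Lemma conj_realC (x : R) : Num.conj x%:C = x%:C :> R[i].
Proof. by apply/conj_Creal/complex_realP; exists x. Qed.

Lemma normc_realB (x y : R) : normc (x%:C - y%:C : R[i]) = `|x - y|.
Proof. by rewrite -normc_real rmorphB. Qed.

Lemma null_normc_uniq (u : nat -> R[i]) z w :
  null (fun n => normc (u n - z)) -> null (fun n => normc (u n - w)) -> z = w.
Proof.
move=> uz uw; apply/eqP; rewrite -subr_eq0; apply/eqP/normc_le0/null_cst.
by apply: null_le (nullD uz uw) => n; rewrite (normc_distC _ z) normc_dist.
Qed.

Lemma normc_complete (u : nat -> R[i]) :
  cauchy_for (@normc R) u -> exists l, cvg_for (@normc R) u l.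
Proof.
move=> cu.
have part (f : R[i] -> R) : (forall z w, f (z - w) = f z - f w) ->
    (forall z, `|f z| <= normc z) -> exists l : R, cvg_for (fun x : R => `|x|) (f \o u) l.
  move=> fB fN; have /cauchy_cvgP/cvg_ex[l ul] : cauchy (f \o u @ \oo).
    apply: cauchy_exP => e /cu[k uk]; exists (f (u k)); exists k => // n /= kn.
    by rewrite /ball/= -fB (le_lt_trans (fN _))// uk.
  exists l => e e0; have [k _ uk] := @cvgr_distC_lt _ _ _ _ _ _ _ ul e e0.
  by exists k => n; exact: uk.
have [x ux] : exists l : R, cvg_for (fun x : R => `|x|) (@complex.Re R \o u) l.
  apply: part => [[a b] [c d]//|[a b]/=].
  by rewrite -sqrtr_sqr ler_wsqrtr// lerDl sqr_ge0.
have [y uy] : exists l : R, cvg_for (fun x : R => `|x|) (@complex.Im R \o u) l.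
  apply: part => [[a b] [c d]//|[a b]/=].
  by rewrite -sqrtr_sqr ler_wsqrtr// lerDr sqr_ge0.
exists (x +i* y)%C => e e0; have e20 : 0 < e / 2 by lra.
have [k xk] := ux _ e20; have [m ym] := uy _ e20.
exists (maxn k m) => n; rewrite geq_max => /andP[/xk/= + /ym/=].
case: (u n) => a b /= h1 h2.
apply: (@le_lt_trans _ _ (`|a - x| + `|b - y|)); last lra.
rewrite -[leRHS]ger0_norm ?addr_ge0// -sqrtr_sqr; apply: ler_wsqrtr.
rewrite -(real_normK (num_real (a - x))) -(real_normK (num_real (b - y))).
by have := normr_ge0 (a - x); have := normr_ge0 (b - y); nra.
Qed.

End ComplexModulus.

(** * Star algebras and square roots *)

Section StarAlgebras.
Context {R : realType} {A : starAlgType R}.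
Implicit Types (a b : A) (k : R[i]).

Lemma starD a b : star (a + b) = star a + star b.
Proof. by have := star_semilinear 1 a b; rewrite rmorph1 !scale1r. Qed.
Lemma star0 : star 0 = 0 :> A.
Proof. by apply: (addrI (star 0)); rewrite -starD !addr0. Qed.
Lemma starZ k a : star (k *: a) = Num.conj k *: star a.
Proof. by have := star_semilinear k a 0; rewrite star0 !addr0. Qed.
Lemma starN a : star (- a) = - star a.
Proof. by apply: (addrI (star a)); rewrite -starD !subrr star0. Qed.
Lemma starB a b : star (a - b) = star a - star b.
Proof. by rewrite starD starN. Qed.
Lemma star1 : star 1 = 1 :> A.
Proof. by rewrite -[LHS]mulr1 -{2}[1]starK -starM mulr1 starK. Qed.

Lemma star_sum (J : Type) (s : seq J) (P : pred J) (F : J -> A) :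
  star (\sum_(i <- s | P i) F i) = \sum_(i <- s | P i) star (F i).
Proof. by elim/big_rec2: _ => [|i x y _ <-]; rewrite ?star0 ?starD. Qed.

End StarAlgebras.

Section StarHomomorphisms.
Context {R : realType} {A B : starAlgType R} {f : A -> B} (fh : star_hom f).
Implicit Types (a b : A) (k : R[i]).

Lemma homL k a b : f (k *: a + b) = k *: f a + f b.
Proof. by case: fh => + _ _ _; exact. Qed.
Lemma hom1 : f 1 = 1. Proof. by case: fh. Qed.
Lemma homM a b : f (a * b) = f a * f b. Proof. by case: fh. Qed.
Lemma hom_star a : f (star a) = star (f a). Proof. by case: fh. Qed.
Lemma homD a b : f (a + b) = f a + f b.
Proof. by have := homL 1 a b; rewrite !scale1r. Qed.
Lemma hom0 : f 0 = 0.
Proof. by apply: (addrI (f 0)); rewrite -homD !addr0. Qed.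
Lemma homZ k a : f (k *: a) = k *: f a.
Proof. by have := homL k a 0; rewrite hom0 !addr0. Qed.
Lemma homN a : f (- a) = - f a.
Proof. by rewrite -scaleN1r homZ scaleN1r. Qed.
Lemma homB a b : f (a - b) = f a - f b.
Proof. by rewrite homD homN. Qed.

End StarHomomorphisms.

Section CStarNorm.
Context {R : realType} {A : cstarType R}.
Implicit Types (a b h y : A) (k : R[i]).

Lemma cnorm0 : cnorm (0 : A) = 0.
Proof. by rewrite -[in LHS](scale0r (0 : A)) cnormZ normc0 mul0r. Qed.
Lemma cnormN a : cnorm (- a) = cnorm a.
Proof. by rewrite -scaleN1r cnormZ normc_opp normc1 mul1r. Qed.
Lemma cnorm_ge0 a : 0 <= cnorm a.
Proof. by have := cnormD a (- a); rewrite subrr cnorm0 cnormN; lra. Qed.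
Lemma cnormB a b : cnorm (a - b) <= cnorm a + cnorm b.
Proof. by rewrite -(cnormN b) cnormD. Qed.
Lemma cnorm_distC a b : cnorm (a - b) = cnorm (b - a).
Proof. by rewrite -cnormN opprB. Qed.

Lemma cnorm_starE a : cnorm (star a) = cnorm a.
Proof.
have le b : cnorm b <= cnorm (star b).
  have [b0|b0] := eqVneq (cnorm b) 0; first by rewrite b0 cnorm_ge0.
  have bp : 0 < cnorm b by rewrite lt_neqAle eq_sym b0 cnorm_ge0.
  by rewrite -(ler_pM2r bp) -expr2 -cnorm_star cnormM.
by apply/eqP; rewrite eq_le le -{2}[a]starK le.
Qed.

Lemma cnorm_le0 a : cnorm a <= 0 -> a = 0.
Proof. by move=> h; apply: cnorm_eq0; apply/eqP; rewrite eq_le h cnorm_ge0. Qed.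

(** Positivity of ||a||^2 - a^* a in every state comes from this square root.
    The equation (1 - y)^2 = 1 - h says that y = (h + y^2) / 2, and this map is
    a contraction of the ball of radius ||h|| < 1; so its iterates from 0, which
    are self-adjoint, converge to a self-adjoint fixed point y. *)
Lemma star_sqrt_one_sub h : star h = h -> cnorm h < 1 ->
  exists y, star y * y = 1 - h.
Proof.
move=> hs; set rho := cnorm h => rho1; have rho0 : 0 <= rho := cnorm_ge0 h.
pose F y : A := (2^-1 : R)%:C *: (h + y * y).
pose y n := iter n F 0.
have half (x : A) : cnorm ((2^-1 : R)%:C *: x) = cnorm x / 2.
  by rewrite cnormZ normc_real ger0_norm ?invr_ge0// mulrC.
have conj_half : Num.conj ((2^-1 : R)%:C) = (2^-1 : R)%:C.
  exact: conj_realC.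
have ys n : star (y n) = y n.
  elim: n => [|n IH]; first exact: star0.
  by rewrite /= -/(y n) starZ conj_half starD starM IH hs.
have yn n : cnorm (y n) <= rho.
  elim: n => [|n IH]; first by rewrite cnorm0.
  rewrite /= -/(y n) half.
  have := cnormD h (y n * y n); rewrite -/rho.
  have := cnormM (y n) (y n); have := cnorm_ge0 (y n); nra.
have Fdist a b : F a - F b = (2^-1 : R)%:C *: (a * (a - b) + (a - b) * b).
  rewrite -scalerBr; congr (_ *: _).
  by rewrite opprD addrACA subrr add0r mulrBr mulrBl addrA subrK.
have FL a b c : cnorm a <= c -> cnorm b <= c ->
    cnorm (F a - F b) <= c * cnorm (a - b).
  move=> ac bc; rewrite Fdist half.
  have := cnormD (a * (a - b)) ((a - b) * b).
  have := cnormM a (a - b); have := cnormM (a - b) b.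
  have := cnorm_ge0 (a - b); nra.
have ydist n m : cnorm (y (n + m)%N - y n) <= rho ^+ n.
  elim: n => [|n IH].
    by rewrite add0n subr0 expr0; apply: le_trans (yn m) _; exact: ltW.
  rewrite addSn exprS; apply: le_trans (FL _ _ _ (yn _) (yn _)) _.
  by rewrite ler_wpM2l.
have rhon : null (fun n => rho ^+ n) by apply: null_expr; rewrite rho0.
have [l yl] : exists l, cvg_for cnorm y l.
  apply: cstar_complete => e e0; have e30 : 0 < e / 3 by lra.
  have [k _ /(_ k (leqnn k)) kn] := rhon _ e30.
  exists k => m n km kn'; have := ydist k (m - k)%N; have := ydist k (n - k)%N.
  rewrite !subnKC// => h1 h2.
  have := cnormB (y m - y k) (y n - y k); rewrite opprB addrA subrK; lra.
have {}yl : null (fun n => cnorm (y n - l)) by apply/null_cvg_for.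
have ls : star l = l.
  apply/eqP; rewrite -subr_eq0; apply/eqP/cnorm_le0/null_cst.
  apply: null_le (nullD yl yl) => n.
  have := cnorm_starE (y n - l); rewrite starB ys => ns.
  have := cnormB (y n - l) (y n - star l).
  by rewrite opprB addrC addrA subrK ns.
have lb : cnorm l <= rho + 1.
  have [k _ /(_ k (leqnn k)) kn] := yl _ ltr01.
  have := cnormB (y k) (y k - l); have := yn k; rewrite opprB addrC subrK; lra.
have Fl : F l = l.
  apply/eqP; rewrite -subr_eq0; apply/eqP/cnorm_le0/null_cst.
  have rp : 0 <= rho + 1 by lra.
  apply: null_le (nullD (null_comp leqnSn yl) (nullZ rp yl)) => n /=.
  have Fnl : cnorm (F (y n) - F l) <= (rho + 1) * cnorm (y n - l).
    by apply: FL => //; have := yn n; lra.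
  have := cnormB (F (y n) - l) (F (y n) - F l).
  rewrite opprB addrC addrA subrK.
  by rewrite -/(y n); lra.
exists (1 - l); rewrite starB star1 ls mulrBl mul1r mulrBr mulr1.
have <- : l + l - l * l = h.
  have two : (2^-1 : R)%:C + (2^-1 : R)%:C = 1.
    by rewrite -rmorphD /= (_ : 2^-1 + 2^-1 = 1 :> R)//; lra.
  by rewrite -[in l + l]Fl /F -scalerDl two scale1r addrK.
by rewrite !opprB opprD -addrA; congr (_ + _); rewrite addrCA.
Qed.

End CStarNorm.

(** * States and their seminorms *)

(** The seminorm of the GNS construction. *)
Definition state_norm (R : realType) (A : starAlgType R) (om : A -> R[i]) (a : A) : R :=
  Num.sqrt (complex.Re (om (star a * a))).

Section States.
Context {R : realType} {A : starAlgType R} {om : A -> R[i]} (os : is_state om).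
Implicit Types (a b : A) (k : R[i]).
Local Notation sn := (state_norm om).

Lemma stateL k a b : om (k *: a + b) = k * om a + om b.
Proof. by case: os => + _ _; exact. Qed.
Lemma state_ge0 a : 0 <= om (star a * a). Proof. by case: os. Qed.
Lemma state1 : om 1 = 1. Proof. by case: os. Qed.
Lemma stateD a b : om (a + b) = om a + om b.
Proof. by have := stateL 1 a b; rewrite scale1r mul1r. Qed.
Lemma state0 : om 0 = 0.
Proof. by apply: (addrI (om 0)); rewrite -stateD !addr0. Qed.
Lemma stateZ k a : om (k *: a) = k * om a.
Proof. by have := stateL k a 0; rewrite state0 !addr0. Qed.
Lemma stateN a : om (- a) = - om a.
Proof. by rewrite -scaleN1r stateZ mulN1r. Qed.
Lemma stateB a b : om (a - b) = om a - om b.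
Proof. by rewrite stateD stateN. Qed.
Lemma state_sum (J : Type) (s : seq J) (P : pred J) (F : J -> A) :
  om (\sum_(i <- s | P i) F i) = \sum_(i <- s | P i) om (F i).
Proof. by elim/big_rec2: _ => [|i x y _ <-]; rewrite ?state0 ?stateD. Qed.

(** Polarization: the values of a state at (a + 1)^* (a + 1) and
    (a + i)^* (a + i) are real, which fixes the real and the imaginary part. *)
Lemma state_star a : om (star a) = Num.conj (om a).
Proof.
have real b : Num.conj (om (star b * b)) = om (star b * b).
  exact/conj_Creal/ger0_real/state_ge0.
have h1 := real (a + 1); have ra := real a.
have h2 := real (a + 'i *: 1).
move: h1 h2; rewrite !(starD, starZ, star1, mulrDl, mulrDr, mul1r, mulr1).
rewrite -!scalerAl -!scalerAr !(mul1r, mulr1).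
rewrite !(stateD, stateZ, state1) !(rmorphD, rmorphM) /= ra rmorph1.
case: (om a) => x y; case: (om (star a)) => z t; case: (om (star a * a)) => p q.
by simpc => -[h1] [h2]; congr (_ +i* _)%C; lra.
Qed.

Lemma state_norm_sqr a : (sn a ^+ 2)%:C = om (star a * a).
Proof.
rewrite sqr_sqrtr; first by rewrite RRe_real// ger0_real// state_ge0.
by rewrite -ler0c RRe_real ?state_ge0// ger0_real// state_ge0.
Qed.

Lemma state_norm_ge0 a : 0 <= sn a. Proof. exact: sqrtr_ge0. Qed.

(** The value at (a - k b)^* (a - k b) is nonnegative; take
    k = g / (sn b ^ 2 + e), where e > 0 covers the case sn b = 0. *)
Lemma state_cauchy_schwarz a b : normc (om (star b * a)) <= sn b * sn a.
Proof.
set g := om (star b * a).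
have gs : om (star a * b) = Num.conj g by rewrite -state_star starM starK.
suff main e : 0 < e -> normc g ^+ 2 <= sn a ^+ 2 * (sn b ^+ 2 + e).
  rewrite -ler_sqr ?nnegrE ?mulr_ge0 ?normc_ge0 ?state_norm_ge0//.
  rewrite exprMn mulrC; apply/ler_addgt0Pr => e e0.
  have p0 : 0 < sn a ^+ 2 + 1 by rewrite ltr_wpDl// sqr_ge0.
  have := main _ (divr_gt0 e0 p0); rewrite mulrDr => /le_trans; apply.
  by rewrite lerD2l mulrC -mulrA ler_piMr ?(ltW e0)// ler_pdivrMl// mulr1 lerDl.
move=> e0; set B := sn b ^+ 2; set G := normc g ^+ 2.
have B0 : 0 <= B by exact: sqr_ge0.
have Be : 0 < B + e by lra.
pose t : R := (B + e)^-1; have t0 : 0 < t by rewrite invr_gt0.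
have tB : t * (B + e) = 1 by rewrite mulVf// gt_eqF.
have : 0 <= sn (a - (t%:C * g) *: b) ^+ 2 by exact: sqr_ge0.
have -> : sn (a - (t%:C * g) *: b) ^+ 2 = sn a ^+ 2 - 2 * t * G + t ^+ 2 * G * B.
  apply: complexI; have GE : G%:C = g * Num.conj g by exact: normc_sqr.
  have BE : B%:C = om (star b * b) by exact: state_norm_sqr.
  have kE k : om (star (a - k *: b) * (a - k *: b)) =
      om (star a * a) - k * Num.conj g - Num.conj k * (g - k * B%:C).
    rewrite BE -gs starB starZ mulrBl !mulrBr.
    rewrite -!(@scalerAl _ A) -!(@scalerAr _ A) !(stateB, stateZ) -/g.
    by congr (_ - (_ - _)); exact: mulrCA.
  rewrite state_norm_sqr kE (rmorphM Num.conj) /= conj_realC -state_norm_sqr.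
  have -> : (sn a ^+ 2 - 2 * t * G + t ^+ 2 * G * B)%:C =
      (sn a ^+ 2)%:C - 2 * t%:C * G%:C + t%:C ^+ 2 * G%:C * B%:C.
    by rewrite !expr2 rmorphD rmorphB !rmorphM rmorph_nat.
  rewrite GE; ring.
have G0 : 0 <= G by exact: sqr_ge0.
have tG : t * G * (B + e) = G by rewrite mulrAC tB mul1r.
have : t ^+ 2 * G * B <= t * G.
  rewrite (_ : t ^+ 2 * G * B = t * G * (t * B)); last by ring.
  rewrite ler_piMr//; first by rewrite mulr_ge0// ltW.
  by rewrite -tB ler_pM2l//; lra.
move=> h1 h2; rewrite -[leLHS]tG; rewrite ler_wpM2r ?(ltW Be)//; lra.
Qed.

Lemma state_normD a b : sn (a + b) <= sn a + sn b.
Proof.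
rewrite -ler_sqr ?nnegrE ?addr_ge0 ?state_norm_ge0//.
have -> : sn (a + b) ^+ 2 =
    sn a ^+ 2 + sn b ^+ 2 + 2 * complex.Re (om (star b * a)).
  have : om (star (a + b) * (a + b)) =
    om (star a * a) + om (star b * b) + (om (star b * a) + Num.conj (om (star b * a))).
    rewrite -state_star starM starK starD mulrDl !mulrDr !stateD; ring.
  rewrite -!state_norm_sqr; case: (om (star b * a)) => x y /=.
  by simpc => -[->]; ring.
have := le_trans (Re_le_normc _) (state_cauchy_schwarz a b).
by rewrite sqrrD; lra.
Qed.

Lemma state_normN a : sn (- a) = sn a.
Proof. by rewrite /state_norm starN mulrNN. Qed.
Lemma state_normB a b : sn (a - b) <= sn a + sn b.
Proof. by rewrite -(state_normN b) state_normD. Qed.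
Lemma state_norm1 : sn 1 = 1.
Proof. by rewrite /state_norm star1 mulr1 state1 sqrtr1. Qed.
Lemma state_normZ k a : sn (k *: a) = normc k * sn a.
Proof.
apply/eqP; rewrite -(@eqrXn2 _ 2) ?mulr_ge0 ?normc_ge0 ?state_norm_ge0//; apply/eqP.
apply: complexI; rewrite exprMn state_norm_sqr rmorphM /= state_norm_sqr.
by rewrite normc_sqr starZ -scalerAl -scalerAr !stateZ mulrCA mulrA.
Qed.
Lemma normc_le_state_norm a : normc (om a) <= sn a.
Proof.
by have := state_cauchy_schwarz a 1; rewrite star1 mul1r state_norm1 mul1r.
Qed.

Lemma state_pullback (B : starAlgType R) (f : B -> A) :
  star_hom f -> is_state (om \o f).
Proof.
move=> fh; split=> [k a b|a|] /=; first by rewrite (homL fh) stateL.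
  by rewrite (homM fh) (hom_star fh) state_ge0.
by rewrite (hom1 fh) state1.
Qed.

Lemma state_conjugate (u : A) : om (star u * u) = 1 ->
  is_state (fun a => om (star u * a * u)).
Proof.
move=> u1; split=> [k a b|a|] /=; last by rewrite mulr1.
  by rewrite mulrDr mulrDl -scalerAr -scalerAl stateL.
by rewrite mulrA -starM -mulrA state_ge0.
Qed.

End States.

Lemma state_norm_comp (R : realType) (A B : starAlgType R) (om : A -> R[i])
  (f : B -> A) (fh : star_hom f) b :
  state_norm (om \o f) b = state_norm om (f b).
Proof. by rewrite /state_norm /= (homM fh) (hom_star fh). Qed.

Section CStarStates.
Context {R : realType} {A : cstarType R} {om : A -> R[i]} (os : is_state om).
Implicit Types (a b : A) (k : R[i]).
Local Notation sn := (state_norm om).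

(** Left multiplication is bounded for the seminorm of a state: for k > ||a||
    the element 1 - a^* a / k^2 is a square y^* y, so the state is nonnegative
    at b^* (1 - a^* a / k^2) b. Right multiplication has no such bound. *)
Lemma state_normM a b : sn (a * b) <= cnorm a * sn b.
Proof.
have [a0|a0] := eqVneq (cnorm a) 0.
  by rewrite (cnorm_eq0 _ a0) mul0r /state_norm mulr0 (state0 os) sqrtr0 cnorm0 mul0r.
have ap : 0 < cnorm a by rewrite lt_neqAle eq_sym a0 cnorm_ge0.
apply/ler_addgt0Pr => e e0.
pose k := cnorm a + e / (sn b + 1).
have s0 := state_norm_ge0 (om := om) b.
have ek : 0 < e / (sn b + 1) by rewrite divr_gt0//; lra.
have k0 : 0 < k by rewrite /k; lra.
have kE : k * sn b <= cnorm a * sn b + e.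
  rewrite mulrDl lerD2l mulrAC ler_pdivrMr; last lra.
  by rewrite ler_pM2l//; lra.
apply: le_trans kE.
pose h : A := ((k ^+ 2)^-1)%:C *: (star a * a).
have hs : star h = h by rewrite starZ starM starK conj_realC.
have h1 : cnorm h < 1.
  rewrite cnormZ cnorm_star normc_real ger0_norm ?invr_ge0 ?sqr_ge0//.
  rewrite ltr_pdivrMl ?exprn_gt0// mulr1 ltr_sqr ?nnegrE ?cnorm_ge0 ?(ltW k0)//.
  by rewrite /k; lra.
have [y yE] := star_sqrt_one_sub hs h1.
rewrite -ler_sqr ?nnegrE ?mulr_ge0 ?state_norm_ge0 ?(ltW k0)//.
have : om (star (y * b) * (y * b)) =
  (sn b ^+ 2)%:C - ((k ^+ 2)^-1)%:C * (sn (a * b) ^+ 2)%:C.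
  rewrite !(state_norm_sqr os) -(stateZ os) -(stateB os) !starM.
  rewrite -!mulrA [star y * _]mulrA yE mulrBl mul1r mulrBr.
  by rewrite /h -scalerAl -scalerAr !mulrA.
rewrite -(state_norm_sqr os) -rmorphM -rmorphB /= => /complexI yb.
have := sqr_ge0 (sn (y * b)); rewrite yb subr_ge0 ler_pdivrMl ?exprn_gt0//.
by rewrite exprMn.
Qed.

Lemma state_norm_le a : sn a <= cnorm a.
Proof. by have := state_normM a 1; rewrite mulr1 (state_norm1 os) mulr1. Qed.

Lemma normc_state_le a : normc (om a) <= cnorm a.
Proof. exact: le_trans (normc_le_state_norm os a) (state_norm_le a). Qed.

End CStarStates.

(** * Elements on which approximate states are determined *)

Section Determination.
Context {R : realType} {A : cstarType R} {W : set (nat -> A -> R[i])}.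
Hypothesis W_state : forall om n, W om -> is_state (om n).
Implicit Types (a b x y : A) (k : R[i]) (Y S : set A).

Definition linear_closed Y := forall k a b, Y a -> Y b -> Y (k *: a + b).

(** The approximation is eventual in each sequence, but the approximating x does
    not depend on the sequence; this is what lets different sequences be
    compared. *)
Definition approx_closed Y := forall a,
  (forall e : R, 0 < e -> exists2 x, Y x & forall om, W om ->
    \forall n \near \oo, state_norm (om n) (a - x) <= e) -> Y a.

Definition approx_span S : set A :=
  smallest [set Y | linear_closed Y /\ approx_closed Y] S.

Lemma approx_span_ind S Y : linear_closed Y -> approx_closed Y ->
  S `<=` Y -> approx_span S `<=` Y.
Proof. by move=> YL Ya SY a; apply. Qed.

Lemma approx_span_incl S : S `<=` approx_span S.
Proof. by move=> a Sa Y [_ SY]; exact: SY. Qed.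

Lemma approx_span_linear S : linear_closed (approx_span S).
Proof.
move=> k a b Sa Sb Y [[YL Ya] SY]; by apply: (YL); [exact: Sa | exact: Sb].
Qed.

Lemma approx_span_closed S : approx_closed (approx_span S).
Proof.
move=> a ax Y [[YL Ya] SY]; apply: (Ya) => e /ax[x Sx xe].
by exists x => //; exact: Sx.
Qed.

Lemma approx_span_invariant S g :
  (forall s, S s -> approx_span S (g * s)) ->
  forall y, approx_span S y -> approx_span S (g * y).
Proof.
move=> gS; apply: approx_span_ind => // [k a b ga gb|a ax].
  by rewrite mulrDr -scalerAr; exact: approx_span_linear.
apply: approx_span_closed => e e0.
have g0 := cnorm_ge0 g; have g1 : 0 < cnorm g + 1 by lra.
have [x gx xe] := ax _ (divr_gt0 e0 g1).
exists (g * x) => // om Wom; near=> n; rewrite -mulrBr.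
apply: le_trans (state_normM (W_state n Wom) _ _) _.
have : state_norm (om n) (a - x) <= e / (cnorm g + 1) by near: n; exact: xe.
rewrite ler_pdivlMr//; have := state_norm_ge0 (om := om n) (a - x); nra.
Unshelve. all: by end_near. Qed.

(** An approximate span that is stable under the generators and their adjoints
    is a left module over everything they generate. The elements that preserve
    it together with their adjoints form a C*-subalgebra, because left
    multiplication is bounded for the seminorms of states. *)
Lemma approx_span_full (G : set A) S :
  (forall D, cstar_subalgebra D -> G `<=` D -> forall a, D a) ->
  (forall g s, G g -> S s ->
    approx_span S (g * s) /\ approx_span S (star g * s)) ->
  S 1 -> forall a, approx_span S a.
Proof.
move=> genG GS S1.
pose D : set A := [set a | forall y, approx_span S y ->
  approx_span S (a * y) /\ approx_span S (star a * y)].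
have Dlim (u : nat -> A) l y : null (fun n => cnorm (u n - l)) ->
    (forall n, approx_span S (u n * y)) -> approx_span S (l * y).
  move=> ul uy; apply: approx_span_closed => e e0.
  have y0 := cnorm_ge0 y; have y1 : 0 < cnorm y + 1 by lra.
  have [N _ /(_ N (leqnn N)) uN] := ul _ (divr_gt0 e0 y1).
  exists (u N * y) => // om Wom; near=> n; rewrite -mulrBl.
  apply: le_trans (state_norm_le (W_state n Wom) _) _.
  apply: le_trans (cnormM _ _) _; rewrite cnorm_distC.
  move: uN; rewrite ler_pdivlMr//; have := cnorm_ge0 (u N - l); nra.
suff Da a : D a.
  by move=> a; rewrite -[a]mulr1; exact: (Da a 1 (approx_span_incl S1)).1.
apply: (genG D) => {a} [|g Gg]; last first.
  move=> y Sy; split; apply: approx_span_invariant Sy => s Ss.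
    exact: (GS g s Gg Ss).1.
  exact: (GS g s Gg Ss).2.
split=> [|k a b Da Db|a b Da Db|a Da|u l Du ul] y Sy.
- by rewrite star1 !mul1r.
- rewrite starD starZ !mulrDl -!scalerAl.
  by split; apply: approx_span_linear; (apply Da || apply Db).
- rewrite starM -!mulrA; split.
    exact: (Da _ (Db _ Sy).1).1.
  exact: (Db _ (Da _ Sy).2).2.
- by rewrite starK; have [] := Da _ Sy.
- have {}ul : null (fun n => cnorm (u n - l)) by apply/null_cvg_for.
  split; first by apply: Dlim ul _ => n; exact: (Du n y Sy).1.
  apply: (Dlim (fun n => star (u n))) => [|n]; last exact: (Du n y Sy).2.
  by apply: null_le ul => n; rewrite -starB cnorm_starE.
Unshelve. all: by end_near. Qed.

(** The indices n and m are independent, so this contains both the convergence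
    of om n a for a single sequence and the equality of limits for two. *)
Definition determined a := forall om om', W om -> W om' ->
  forall e : R, 0 < e -> exists N, forall n m, (N <= n)%N -> (N <= m)%N ->
  normc (om n a - om' m a) <= e.

(** Two sequences of W that have the same limits on S have the same limits on
    the whole approximate span, by |om b| <= state_norm om b. *)
Lemma approx_span_determined S :
  (forall s, S s -> exists z, forall om, W om ->
    null (fun n => normc (om n s - z))) ->
  approx_span S `<=` determined.
Proof.
move=> Sz; apply: approx_span_ind => [k a b da db|a ax|s /Sz[z sz]] om om' Wom Wom' e e0.
- have k0 := normc_ge0 k; have k1 : 0 < normc k + 1 by lra.
  have e2 : 0 < e / 2 by lra.
  have [N aN] := da om om' Wom Wom' _ (divr_gt0 e2 k1).
  have [M bM] := db om om' Wom Wom' _ e2.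
  exists (maxn N M) => n m; rewrite !geq_max => /andP[Nn Mn] /andP[Nm Mm].
  have := aN n m Nn Nm; rewrite ler_pdivlMr// => h1; have h2 := bM n m Mn Mm.
  rewrite !(stateL (W_state _ _))// opprD addrACA -mulrBr.
  apply: le_trans (normcD _ _) _; rewrite normcM.
  have := normc_ge0 (om n a - om' m a); nra.
(* Compare om n a and om' m a through the values at a common approximant. *)
- have e3 : 0 < e / 3 by lra.
  have [x dx xe] := ax _ e3.
  have [N xN] := dx om om' Wom Wom' _ e3.
  have [M _ aM] := xe om Wom; have [K _ aK] := xe om' Wom'.
  exists (maxn N (maxn M K)) => n m; rewrite !geq_max.
  move=> /and3P[Nn Mn Kn] /and3P[Nm Mm Km].
  have h1 := xN n m Nn Nm.
  have h2 := le_trans (normc_le_state_norm (W_state n Wom) _) (aM n Mn).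
  have h3 := le_trans (normc_le_state_norm (W_state m Wom') _) (aK m Km).
  rewrite (stateB (W_state n Wom)) in h2; rewrite (stateB (W_state m Wom')) in h3.
  have := normc_dist (om n a) (om' m a) (om n x).
  have := normc_dist (om n x) (om' m a) (om' m x).
  rewrite (normc_distC (om' m x)); lra.
- have e2 : 0 < e / 2 by lra.
  have [N _ sN] := sz om Wom _ e2; have [M _ sM] := sz om' Wom' _ e2.
  exists (maxn N M) => n m; rewrite !geq_max => /andP[Nn _] /andP[_ Mm].
  have := normc_dist (om n s) (om' m s) z; rewrite (normc_distC z).
  have := sN n Nn; have := sM m Mm; rewrite /=; lra.
Qed.

(** The state f of C describes the limits of the states of W on u^* j(C) u,
    so an error g j(d N) u is small as soon as d N is small for f. *)
Lemma approx_span_limit (C : cstarType R) (j : C -> A) (f : C -> R[i])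
    (d : nat -> C) (x : nat -> A) (u g a : A) S :
  star_hom j -> is_state f ->
  (forall om c, W om -> null (fun n => normc (om n (star u * j c * u) - f c))) ->
  null (fun N => state_norm f (d N)) ->
  (forall N, approx_span S (x N)) ->
  (forall N, a - x N = g * (j (d N) * u)) -> approx_span S a.
Proof.
move=> jh fs Wf d0 xS ax; apply: approx_span_closed => e e0.
have g0 := cnorm_ge0 g; have g1 : 0 < cnorm g + 1 by lra.
have [e' e'0 e'E] : exists2 e', 0 < e' & 2 * e' * (cnorm g + 1) = e.
  exists (e / (cnorm g + 1) / 2); first by rewrite !divr_gt0.
  by rewrite mulrCA mulfV ?pnatr_eq0// mulr1 mulfVK// gt_eqF.
have [N _ /(_ N (leqnn N)) /= dN] := d0 _ e'0.
exists (x N) => // om Wom; rewrite ax.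
have e'20 : 0 < e' ^+ 2 by rewrite exprn_gt0.
near=> n; apply: le_trans (state_normM (W_state n Wom) _ _) _.
suff h : state_norm (om n) (j (d N) * u) <= 2 * e'.
  have := state_norm_ge0 (om := om n) (j (d N) * u); nra.
rewrite -ler_sqr ?nnegrE ?mulr_ge0 ?state_norm_ge0// ?(ltW e'0)//.
have : normc (om n (star u * j (star (d N) * d N) * u) - f (star (d N) * d N)) <= e' ^+ 2.
  by near: n; exact: Wf.
rewrite -mulrA -(state_norm_sqr fs) => h.
have := state_norm_sqr (W_state n Wom) (j (d N) * u).
rewrite starM -!mulrA [star (j _) * _]mulrA -(hom_star jh) -(homM jh) => E.
move: h; rewrite -E normc_realB => /ler_normlP[_ h].
have f0 := state_norm_ge0 (om := f) (d N).
have : state_norm f (d N) ^+ 2 <= e' ^+ 2 by rewrite ler_sqr ?nnegrE ?(ltW e'0).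
by rewrite exprMn; have := sqr_ge0 e'; lra.
Unshelve. all: by end_near. Qed.

End Determination.

(** * Limits and corners of states *)

Section Limits.
Context {R : realType} {A : cstarType R}.
Implicit Types (u : nat -> A) (a l : A).

Lemma null_cnorm_mull a u l :
  null (fun n => cnorm (u n - l)) -> null (fun n => cnorm (a * u n - a * l)).
Proof.
move=> ul; apply: null_le (nullZ (cnorm_ge0 a) ul) => n.
by rewrite -mulrBr cnormM.
Qed.

Lemma null_cnorm_mulr a u l :
  null (fun n => cnorm (u n - l)) -> null (fun n => cnorm (u n * a - l * a)).
Proof.
move=> ul; apply: null_le (nullZ (cnorm_ge0 a) ul) => n.
by rewrite -mulrBl mulrC cnormM.
Qed.

Lemma state_lim (om : A -> R[i]) u l : is_state om ->
  null (fun n => cnorm (u n - l)) -> null (fun n => normc (om (u n) - om l)).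
Proof. by move=> os; apply: null_le => n; rewrite -(stateB os) normc_state_le. Qed.

(** Reduces traciality of a state to a set of generators. *)
Lemma tracial_element_subalgebra (om : A -> R[i]) : is_state om ->
  cstar_subalgebra [set b | forall a, om (a * b) = om (b * a)].
Proof.
move=> os; split=> [a|k b c bZ cZ a|b c bZ cZ a|b bZ a|u l uZ /null_cvg_for ul a].
- by rewrite mulr1 mul1r.
- by rewrite mulrDr mulrDl -scalerAr -scalerAl !(stateL os) bZ cZ.
- by rewrite mulrA cZ mulrA bZ mulrA.
- by rewrite -[a]starK -!starM !(state_star os) bZ.
- apply: null_normc_uniq (state_lim os (null_cnorm_mull a ul)) _.
  apply: null_le (state_lim os (null_cnorm_mulr a ul)) => n.
  by rewrite uZ.
Qed.

Lemma tracial_state_norm_star (om : A -> R[i]) a : tracial om ->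
  state_norm om (star a) = state_norm om a.
Proof. by move=> ot; rewrite /state_norm starK ot. Qed.

End Limits.

Section Corners.
Context {R : realType} {A : cstarType R} {om : A -> R[i]} (os : is_state om).
Variable q : A.
Hypotheses (qs : star q = q) (qq : q * q = q).
Local Notation sn := (state_norm om).

Lemma state_norm_projection : sn q ^+ 2 = complex.Re (om q).
Proof.
apply: complexI; rewrite (state_norm_sqr os) qs qq RRe_real// -qq -{1}qs.
by rewrite ger0_real// (state_ge0 os).
Qed.

Lemma cnorm_projection : cnorm q <= 1.
Proof.
have := cnorm_star q; rewrite qs qq => e.
by have := cnorm_ge0 q; nra.
Qed.

Lemma state_mul_projection x : normc (om (q * x)) <= sn q * cnorm x.
Proof.
rewrite -[in q * x]qs; apply: le_trans (state_cauchy_schwarz os _ _) _.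
by rewrite ler_wpM2l ?state_norm_ge0 ?state_norm_le.
Qed.

Lemma state_projection_mul x : normc (om (x * q)) <= cnorm x * sn q.
Proof.
by apply: le_trans (normc_le_state_norm os _) _; exact: state_normM.
Qed.

End Corners.

Section ComplementaryCorner.
Context {R : realType} {A : cstarType R} {om : A -> R[i]} (os : is_state om).
Variable q : A.
Hypotheses (qs : star q = q) (qq : q * q = q).
Local Notation sn := (state_norm om).

Let qs' : star (1 - q) = 1 - q. Proof. by rewrite starB star1 qs. Qed.
Let qq' : (1 - q) * (1 - q) = 1 - q.
Proof. by rewrite mulrBl mul1r mulrBr mulr1 qq subrr subr0. Qed.

Lemma state_norm_complement : sn (1 - q) <= Num.sqrt (normc (om q - 1)).
Proof.
rewrite -ler_sqr ?nnegrE ?sqrtr_ge0// (state_norm_projection os qs' qq').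
rewrite sqr_sqrtr ?normc_ge0// (stateB os) (state1 os).
by rewrite normc_distC Re_le_normc.
Qed.

(** A state is almost carried by the corner of q as soon as om q is close to 1. *)
Lemma state_corner x :
  normc (om x - om (q * x * q)) <= sn (1 - q) * cnorm x + cnorm (q * x) * sn (1 - q).
Proof.
have -> : om x - om (q * x * q) = om ((1 - q) * x) + om (q * x * (1 - q)).
  by rewrite -(stateB os) -(stateD os) mulrBl mul1r mulrBr mulr1 addrA subrK.
by apply: le_trans (normcD _ _) _; apply: lerD;
  [exact: state_mul_projection | exact: state_projection_mul].
Qed.

End ComplementaryCorner.

(** * The CAR algebra *)

Section MatrixUnits.
Context {K : comNzRingType} {n : nat}.
Implicit Types (a : 'M[K]_n) (k l : 'I_n).

Lemma mul_delta_mx_mx k l a : delta_mx k l *m a = \sum_q a l q *: delta_mx k q.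
Proof.
apply/matrixP => i j; rewrite mxE summxE (bigD1 l)//= [RHS](bigD1 j)//=.
rewrite big1 => [|p pl]; last by rewrite mxE (negbTE pl) andbF mul0r.
rewrite big1 => [|p pj]; last by rewrite !mxE [j == p]eq_sym (negbTE pj) andbF mulr0.
by rewrite !mxE !eqxx !andbT mulrC.
Qed.

Lemma mul_mx_delta_mx k l a : a *m delta_mx l k = \sum_q a q l *: delta_mx q k.
Proof.
apply/matrixP => i j; rewrite mxE summxE (bigD1 l)//= [RHS](bigD1 i)//=.
rewrite big1 => [|p pl]; last by rewrite mxE (negbTE pl) mulr0.
rewrite big1 => [|p pj]; last by rewrite !mxE [i == p]eq_sym (negbTE pj) mulr0.
by rewrite !mxE !eqxx.
Qed.

Lemma delta_mx_sandwich k l a : delta_mx k l *m a *m delta_mx l k = a l l *: delta_mx k k.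
Proof.
rewrite mul_delta_mx_mx mulmx_suml (bigD1 l)//= -scalemxAl mul_delta_mx.
rewrite big1 ?addr0// => p pl.
by rewrite -scalemxAl mul_delta_mx_0 ?scaler0.
Qed.

End MatrixUnits.

Section CAR.
Context {R : realType} {C : cstarType R} {iota : forall n, 'M[R[i]]_(qdim n) -> C}.
Arguments iota : clear implicits.
Hypothesis C_CAR : CAR_algebra iota.
Implicit Types (c d : C).

Lemma iotaL n (k : R[i]) a b : iota n (k *: a + b) = k *: iota n a + iota n b.
Proof. by have [+ _ _] := C_CAR; move=> /(_ n)[+ _ _ _ _]; exact. Qed.
Lemma iota1 n : iota n 1%:M = 1.
Proof. by have [+ _ _] := C_CAR; move=> /(_ n)[]. Qed.
Lemma iotaM n a b : iota n (a *m b) = iota n a * iota n b.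
Proof. by have [+ _ _] := C_CAR; move=> /(_ n)[]. Qed.
Lemma iota_star n a : iota n (map_mx Num.conj a^T) = star (iota n a).
Proof. by have [+ _ _] := C_CAR; move=> /(_ n)[]. Qed.
Lemma iotaD n a b : iota n (a + b) = iota n a + iota n b.
Proof. by have := iotaL 1 a b; rewrite !scale1r. Qed.
Lemma iota0 n : iota n 0 = 0.
Proof. by apply: (addrI (iota n 0)); rewrite -iotaD !addr0. Qed.
Lemma iotaZ n k a : iota n (k *: a) = k *: iota n a.
Proof. by have := iotaL k a 0; rewrite iota0 !addr0. Qed.
Lemma iota_sum n (J : Type) (s : seq J) (P : pred J) F :
  iota n (\sum_(i <- s | P i) F i) = \sum_(i <- s | P i) iota n (F i).
Proof. by elim/big_rec2: _ => [|i x y _ <-]; rewrite ?iota0 ?iotaD. Qed.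

Lemma iota_le n m a : (n <= m)%N -> exists b, iota m b = iota n a.
Proof.
have [_ iS _] := C_CAR.
elim: m => [|m IH] in n a *; first by rewrite leqn0 => /eqP n0; subst n; exists a.
rewrite leq_eqVlt => /predU1P[nm|nm]; first by subst n; exists a.
by have [b <-] := IH n a nm; exists (tens2 b 1%:M); rewrite iS.
Qed.

(** The union of the matrix algebras is dense. *)
Lemma CAR_ind (P : set C) :
  (forall u l, (forall n, P (u n)) -> null (fun n => cnorm (u n - l)) -> P l) ->
  (forall n a, P (iota n a)) -> forall c, P c.
Proof.
move=> Plim Pi c; have [_ _ dense] := C_CAR.
have /choice[u uP] : forall n : nat, exists x, P x /\ cnorm (c - x) < 2^-1 ^+ n.
  move=> n; have [|m [a ac]] := dense c (2^-1 ^+ n); last by exists (iota m a).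
  by rewrite exprn_gt0// invr_gt0.
apply: (Plim u) => [n|]; first exact: (uP n).1.
have /null_le : null (fun n => (2^-1 : R) ^+ n).
  by apply: null_expr; rewrite invr_ge0 ler0n invf_lt1// ltr1n.
by apply=> n; rewrite cnorm_distC ltW// (uP n).2.
Qed.

Lemma states_cvg_CAR (f : nat -> C -> R[i]) (g : C -> R[i]) :
  (forall n, is_state (f n)) -> is_state g ->
  (forall m a, null (fun n => normc (f n (iota m a) - g (iota m a)))) ->
  forall c, null (fun n => normc (f n c - g c)).
Proof.
move=> fs gs fg; apply: CAR_ind => // u l uP ul e e0.
have e3 : 0 < e / 3 by lra.
have [k _ /(_ k (leqnn k)) /= kl] := ul _ e3.
near=> n.
have : normc (f n (u k) - g (u k)) <= e / 3 by near: n; exact: uP.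
have := normc_state_le (fs n) (u k - l); have := normc_state_le gs (u k - l).
rewrite (stateB (fs n)) (stateB gs).
have := normc_dist (f n l) (g l) (f n (u k)).
have := normc_dist (f n (u k)) (g l) (g (u k)).
rewrite (normc_distC (f n l) (f n (u k))); lra.
Unshelve. all: by end_near. Qed.

Lemma state_eq_CAR (f g : C -> R[i]) : is_state f -> is_state g ->
  (forall n a, f (iota n a) = g (iota n a)) -> f = g.
Proof.
move=> fs gs fg; apply/funext; apply: CAR_ind => // u l ufg ul.
apply: null_normc_uniq (state_lim fs ul) _.
by under eq_fun do rewrite ufg; exact: state_lim.
Qed.

Lemma e00_tens_delta n : exists k, e00_tens n = delta_mx k k :> 'M[R[i]]_(qdim n).
Proof.
elim: n => [|n [k IH]].
  by exists ord0; apply/matrixP => i j; rewrite !ord1 !mxE eqxx.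
exists (mxtens_index (k, 0)); rewrite /= IH; apply/matrixP => i j.
case: (mxtens_indexP i) => i1 i2; case: (mxtens_indexP j) => j1 j2.
rewrite tensmxE !mxE !(inj_eq (can_inj (@mxtens_indexK _ _))) !xpair_eqE.
by rewrite -natrM mulnb andbACA.
Qed.

Local Notation q := (qproj iota).

Lemma qproj0 : q 0 = 1. Proof. exact: iota1. Qed.

Lemma qproj_star n : star (q n) = q n.
Proof.
rewrite /qproj -iota_star; have [k ->] := e00_tens_delta n.
by rewrite trmx_delta map_delta_mx.
Qed.

Lemma qprojK n : q n * q n = q n.
Proof.
by rewrite /qproj -iotaM; have [k ->] := e00_tens_delta n; rewrite mul_delta_mx.
Qed.

Lemma qproj_succ n : q n * q n.+1 = q n.+1.
Proof.
have [_ iS _] := C_CAR; rewrite /qproj -iS -iotaM /= /tens2 tensmx_mul mul1mx.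
by have [k ->] := e00_tens_delta n; rewrite mul_delta_mx.
Qed.

Lemma qproj_mul n m : (n <= m)%N -> q n * q m = q m.
Proof.
elim: m => [|m IH]; first by rewrite leqn0 => /eqP->; exact: qprojK.
rewrite leq_eqVlt => /predU1P[->|/IH nm]; first exact: qprojK.
by rewrite -(qproj_succ m) mulrA nm.
Qed.

(** The projection q n has rank one in C_n, so it compresses C_n to scalars. *)
Lemma qproj_compress n a : exists k : R[i], q n * iota n a * q n = k *: q n.
Proof.
have [k qE] := e00_tens_delta n; exists (a k k).
by rewrite /qproj qE -!iotaM -iotaZ delta_mx_sandwich.
Qed.

Section ProductState.
Variable phi : C -> R[i].
Hypothesis phi_prod : product_state iota phi.

Let phi_state : is_state phi. Proof. by case: phi_prod. Qed.

Lemma product_state_qproj n : phi (q n) = 1.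
Proof.
have [_ phiM] := phi_prod; elim: n => [|n IH]; first by rewrite qproj0 (state1 phi_state).
by rewrite /qproj /= phiM -/(q n) IH mxE mul1r.
Qed.

Lemma product_state_complement n : state_norm phi (1 - q n) = 0.
Proof.
apply/eqP; rewrite eq_le state_norm_ge0 andbT.
apply: le_trans (state_norm_complement phi_state (qproj_star n) (qprojK n)) _.
by rewrite product_state_qproj subrr normc0 sqrtr0.
Qed.

Lemma qproj_compress_state n a :
  q n * iota n a * q n = phi (iota n a) *: q n.
Proof.
have [k kE] := qproj_compress a; rewrite kE; congr (_ *: _).
have := state_corner phi_state (qproj_star n) (iota n a).
rewrite kE product_state_complement mul0r mulr0 addr0 => /normc_le0/eqP.
by rewrite subr_eq0 (stateZ phi_state) product_state_qproj mulr1 => /eqP.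
Qed.

(** The projections q N excise phi: phi is the only limit of states whose values
    at every q N tend to 1, because q N compresses C_N to the multiples
    phi(x) q N of q N. *)
Lemma product_state_excision (f : nat -> C -> R[i]) :
  (forall n, is_state (f n)) ->
  (forall N, null (fun n => normc (f n (q N) - 1))) ->
  forall c, null (fun n => normc (f n c - phi c)).
Proof.
move=> fs fq; apply: states_cvg_CAR => // N a.
pose x := iota N a; pose d n := Num.sqrt (normc (f n (q N) - 1)).
have d0 : null d by apply: null_sqrt; exact: fq.
have K0 : 0 <= cnorm x + cnorm (q N * x) by rewrite addr_ge0 ?cnorm_ge0.
apply: null_le (nullD (nullZ K0 d0) (nullZ (normc_ge0 (phi x)) (fq N))) => n.
apply: le_trans (normc_dist _ _ (f n (q N * x * q N))) _; apply: lerD.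
  have := state_corner (fs n) (qproj_star N) x.
  have : state_norm (f n) (1 - q N) <= d n.
    exact: (state_norm_complement (fs n) (qproj_star N) (qprojK N)).
  have := cnorm_ge0 x; have := cnorm_ge0 (q N * x).
  have := state_norm_ge0 (om := f n) (1 - q N); rewrite -/x; nra.
rewrite /x qproj_compress_state (stateZ (fs n)) -normcM mulrBr mulr1//.
Qed.

(** In the GNS representation of phi this says that the projections q n converge
    strongly to the projection onto the cyclic vector. *)
Lemma product_state_excision_norm c :
  null (fun n => state_norm phi (q n * c - phi c *: 1)).
Proof.
move: c; apply: CAR_ind => [u l uP ul e e0|N a].
  have e3 : 0 < e / 3 by lra.
  have [k _ /(_ k (leqnn k)) /= kl] := ul _ e3.
  near=> n.
  have : state_norm phi (q n * u k - phi (u k) *: 1) <= e / 3 by near: n; exact: uP.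
  have -> : q n * l - phi l *: 1 =
    (q n * u k - phi (u k) *: 1) + (q n * (l - u k) - phi (l - u k) *: 1).
    rewrite (stateB phi_state) mulrBr scalerBl addrACA -opprD.
    by congr (_ - _); rewrite addrC subrK.
  have := state_normD phi_state (q n * u k - phi (u k) *: 1) (q n * (l - u k) - phi (l - u k) *: 1).
  have := state_normB phi_state (q n * (l - u k)) (phi (l - u k) *: 1).
  have := state_norm_le phi_state (q n * (l - u k)).
  have := cnormM (q n) (l - u k).
  have := cnorm_projection (qproj_star n) (qprojK n).
  have := cnorm_ge0 (q n); have := cnorm_ge0 (l - u k).
  have := normc_state_le phi_state (l - u k).
  rewrite (state_normZ phi_state) (state_norm1 phi_state) mulr1 (cnorm_distC l); nra.
apply: null_near null0; exists N => // n /= Nn; have [b <-] := iota_le a Nn.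
set x := iota n b.
have -> : q n * x - phi x *: 1 =
  (q n * x - phi x *: 1) * (1 - q n) + (q n * x * q n - phi x *: q n).
  by rewrite mulrBr mulr1 [(_ - _) * q n]mulrBl -scalerAl mul1r subrK.
rewrite /x qproj_compress_state subrr addr0.
apply: le_trans (state_normM phi_state _ _) _.
by rewrite product_state_complement mulr0.
Unshelve. all: by end_near. Qed.

End ProductState.

Lemma qdim_pow2 n : (qdim n)%:R = 2 ^+ n :> R[i].
Proof. by elim: n => //= n IH; rewrite natrM IH exprSr. Qed.

Section Averaging.
Context {B : starAlgType R} {j : C -> B} (jh : star_hom j).
Local Notation unit n k l := (j (iota n (delta_mx k l))).

(** The conditional expectation of B onto the commutant of j(C_n). *)
Definition average n (x : B) : B :=
  (2 ^+ n)^-1 *: \sum_k \sum_l unit n k l * x * unit n l k.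

Let pow2 n : (2 : R[i]) ^+ n != 0. Proof. by rewrite expf_neq0// pnatr_eq0. Qed.

(** Averaging x over the matrix units of C_n turns every state of B into one that
    extends the trace of C_n; by average_mulC it also makes the state commute
    with C_n. *)
Lemma average_iota n a : average n (j (iota n a)) = (\tr a / 2 ^+ n) *: 1.
Proof.
rewrite /average exchange_big /=.
under eq_bigr => l _.
  under eq_bigr => k _ do rewrite -!(homM jh) -!iotaM delta_mx_sandwich iotaZ (homZ jh).
  rewrite -scaler_sumr; over.
rewrite -scaler_suml mulrC -scalerA; congr (_ *: (_ *: _)).
rewrite -(hom1 jh) -(iota1 n) mx1_sum_delta iota_sum.
by elim/big_rec2: _ => [|k x y _ ->]; rewrite ?(hom0 jh) ?(homD jh).
Qed.

Lemma average1 n : average n 1 = 1.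
Proof.
by rewrite -(hom1 jh) -(iota1 n) average_iota mxtrace1 qdim_pow2 divff// scale1r iota1 (hom1 jh).
Qed.

Lemma average_mulC n a x : average n (j (iota n a) * x) = average n (x * j (iota n a)).
Proof.
rewrite /average; congr (_ *: _); apply: eq_bigr => k _.
have jsum (F : 'I_(qdim n) -> C) : j (\sum_l F l) = \sum_l j (F l).
  by elim/big_rec2: _ => [|l y z _ <-]; rewrite ?(hom0 jh) ?(homD jh).
transitivity (\sum_l \sum_p a l p *: (unit n k p * x * unit n l k)).
  apply: eq_bigr => l _; rewrite mulrA -(homM jh) -iotaM mul_delta_mx_mx iota_sum.
  rewrite jsum !mulr_suml; apply: eq_bigr => p _.
  by rewrite iotaZ (homZ jh) -!scalerAl.
rewrite exchange_big /=; apply: eq_bigr => l _.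
rewrite -!mulrA -(homM jh) -iotaM mul_mx_delta_mx iota_sum jsum !mulr_sumr.
apply: eq_bigr => p _.
by rewrite iotaZ (homZ jh) -!scalerAr mulrA.
Qed.

Lemma average_state n (v : B -> R[i]) : is_state v -> is_state (v \o average n).
Proof.
move=> vs; split=> [k a b|a|] /=.
- rewrite -(stateL vs) /average scalerA mulrC -scalerA -scalerDr.
  congr (v (_ *: _)); rewrite scaler_sumr -big_split; apply: eq_bigr => i _ /=.
  rewrite scaler_sumr -big_split; apply: eq_bigr => l _ /=.
  by rewrite mulrDr mulrDl -scalerAr -scalerAl.
- rewrite /average (stateZ vs) mulr_ge0 ?invr_ge0 ?exprn_ge0//.
  rewrite (state_sum vs) sumr_ge0// => k _; rewrite (state_sum vs) sumr_ge0// => l _.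
  have -> : unit n k l = star (unit n l k).
    by rewrite -(hom_star jh) -iota_star trmx_delta map_delta_mx.
  by rewrite mulrA -starM -mulrA (state_ge0 vs).
- by rewrite average1 (state1 vs).
Qed.

Lemma tracial_average n (t : B -> R[i]) x : is_state t -> tracial t ->
  t (average n x) = t x.
Proof.
move=> ts tt; rewrite /average (stateZ ts) (state_sum ts).
under eq_bigr => k _.
  rewrite (state_sum ts).
  under eq_bigr => l _ do rewrite tt mulrA -(homM jh) -iotaM mul_delta_mx.
  rewrite -(state_sum ts) -mulr_suml; over.
rewrite sumr_const card_ord -[t _ *+ _]mulr_natl qdim_pow2 mulrA mulVf// mul1r.
rewrite (_ : \sum_i _ = 1) ?mul1r// -(hom1 jh) -(iota1 n) mx1_sum_delta iota_sum.
by elim/big_rec2: _ => [|k y z _ ->]; rewrite ?(hom0 jh) ?(homD jh).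
Qed.

End Averaging.

Section Trace.
Variable tau : C -> R[i].
Hypothesis tau_trace : normalized_trace iota tau.

Lemma trace_state : is_state tau. Proof. by case: tau_trace. Qed.
Lemma trace_iota n a : tau (iota n a) = \tr a / 2 ^+ n.
Proof. by case: tau_trace. Qed.

Lemma trace_tracial : tracial tau.
Proof.
have [_ _ _ _ limZ] := tracial_element_subalgebra trace_state.
move=> c d; move: d c; apply: CAR_ind => [u l uP ul c|n b].
  by apply: (limZ u l) => //; apply/null_cvg_for.
apply: CAR_ind => [u l uP ul|m a].
  apply: null_normc_uniq (state_lim trace_state (null_cnorm_mull _ ul)).
  apply: null_le (state_lim trace_state (null_cnorm_mulr (iota n b) ul)) => k.
  by rewrite uP.
have [a' <-] := iota_le a (leq_maxl m n); have [b' <-] := iota_le b (leq_maxr m n).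
by rewrite -!iotaM !trace_iota mxtrace_mulC.
Qed.

(** A tracial state is unchanged by averaging, and averaging C_n leaves only the
    normalized trace. *)
Lemma tracial_state_CAR (t : C -> R[i]) : is_state t -> tracial t -> t = tau.
Proof.
move=> ts tt; apply: (state_eq_CAR ts trace_state) => n a.
have idh : star_hom (@idfun C) by split.
rewrite -(tracial_average idh n _ ts tt) (average_iota idh) trace_iota.
by rewrite (stateZ ts) (state1 ts) mulr1.
Qed.

Lemma trace_qproj n : tau (q n) = (2 ^+ n)^-1.
Proof.
have [k qE] := e00_tens_delta n; rewrite /qproj trace_iota qE.
rewrite /mxtrace (bigD1 k)//= mxE !eqxx big1 => [|p pk]; last by rewrite mxE (negbTE pk).
by rewrite addr0 mul1r.
Qed.

End Trace.
End CAR.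

(** * Limits of states *)

Section LimitState.
Context {R : realType} {A : starAlgType R}.

Lemma null_normc_linear (k : R[i]) (u v : nat -> R[i]) x y :
  null (fun n => normc (u n - x)) -> null (fun n => normc (v n - y)) ->
  null (fun n => normc (k * u n + v n - (k * x + y))).
Proof.
move=> ux vy; apply: null_le (nullD (nullZ (normc_ge0 k) ux) vy) => n.
by rewrite opprD addrACA -mulrBr -normcM normcD.
Qed.

Lemma null_normc_ge0 (u : nat -> R[i]) x :
  (forall n, 0 <= u n) -> null (fun n => normc (u n - x)) -> 0 <= x.
Proof.
move=> u0 ux; suff -> : x = (normc x)%:C by rewrite ler0c normc_ge0.
apply: null_normc_uniq (ux) _; apply: null_le ux => n.
have -> : u n = (normc (u n))%:C by rewrite normC_normc ger0_norm.
rewrite normc_realB; set y := (normc (u n))%:C.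
have yE : normc y = normc (u n) by rewrite normc_real ger0_norm ?normc_ge0.
rewrite -yE; apply/ler_normlP; split.
  by have := normcD (x - y) y; rewrite subrK (normc_distC x); lra.
by have := normcD (y - x) x; rewrite subrK; lra.
Qed.

Lemma limit_state (om : nat -> A -> R[i]) f :
  (forall n, is_state (om n)) ->
  (forall a, null (fun n => normc (om n a - f a))) -> is_state f.
Proof.
move=> os of_; split=> [k a b|a|].
- apply: null_normc_uniq (of_ _) _.
  apply: null_le (null_normc_linear k (of_ a) (of_ b)) => n.
  by rewrite (stateL (os n)).
- by apply: null_normc_ge0 (of_ _) => n; exact: state_ge0.
- apply: null_normc_uniq (of_ _) _.
  by apply: null_le null0 => n; rewrite (state1 (os n)) subrr normc0.
Qed.

End LimitState.

(** * Excision and the trace under automorphisms *)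

Section Automorphisms.
Context {R : realType} {C : cstarType R} {iota : forall n, 'M[R[i]]_(qdim n) -> C}.
Arguments iota : clear implicits.
Hypothesis C_CAR : CAR_algebra iota.
Variables (phi0 phi : C -> R[i]) (alpha : C -> C).
Hypotheses (phi0_prod : product_state iota phi0)
  (alpha_aut : star_automorphism alpha) (phi_alpha : forall a, phi (alpha a) = phi0 a).
Local Notation p := (pproj iota alpha).

Let alpha_hom : star_hom alpha. Proof. by case: alpha_aut. Qed.
Let phi_alphaE : phi \o alpha = phi0. Proof. exact/funext. Qed.
Let alpha_surj c : exists d, alpha d = c.
Proof. by case: alpha_aut => _ [b _ bK]; exists (b c). Qed.

Lemma pproj_star n : star (p n) = p n.
Proof. by rewrite /pproj -(hom_star alpha_hom) (qproj_star C_CAR). Qed.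

Lemma pproj_mul n m : (n <= m)%N -> p n * p m = p m.
Proof. by move=> nm; rewrite /pproj -(homM alpha_hom) (qproj_mul C_CAR). Qed.

(** The automorphism carries the excision of the product state by q N over to
    phi and the projections p N. *)
Lemma state_excision (f : nat -> C -> R[i]) :
  (forall n, is_state (f n)) ->
  (forall N, null (fun n => normc (f n (p N) - 1))) ->
  forall c, null (fun n => normc (f n c - phi c)).
Proof.
move=> fs fp c; have [d <-] := alpha_surj c; rewrite phi_alpha.
apply: (product_state_excision C_CAR phi0_prod (f := fun n => f n \o alpha)) => //.
by move=> n; exact: state_pullback.
Qed.

Lemma state_excision_norm c : null (fun n => state_norm phi (p n * c - phi c *: 1)).
Proof.
have [d <-] := alpha_surj c; rewrite phi_alpha.
apply: null_le (product_state_excision_norm C_CAR phi0_prod d) => n.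
rewrite -phi_alphaE (state_norm_comp _ alpha_hom) (homB alpha_hom) (homZ alpha_hom).
by rewrite (homM alpha_hom) (hom1 alpha_hom).
Qed.

Section Trace.
Variable tau : C -> R[i].
Hypothesis tau_trace : normalized_trace iota tau.
Let tau_state : is_state tau := trace_state tau_trace.
Let tau_tracial : tracial tau := trace_tracial C_CAR tau_trace.

Lemma trace_automorphism : tau \o alpha = tau.
Proof.
apply: (tracial_state_CAR C_CAR tau_trace) => [|a b /=]; first exact: state_pullback.
by rewrite !(homM alpha_hom).
Qed.

Lemma trace_norm_pproj : null (fun n => state_norm tau (p n)).
Proof.
have : null (fun n => Num.sqrt ((2^-1 : R) ^+ n)).
  by apply/null_sqrt/null_expr; rewrite invr_ge0 ler0n invf_lt1// ltr1n.
apply: null_le => n.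
rewrite -(state_norm_comp tau alpha_hom) trace_automorphism.
rewrite /state_norm (qproj_star C_CAR) (qprojK C_CAR) (trace_qproj tau_trace).
rewrite exprVn (_ : (2 ^+ n)^-1 = ((2 ^+ n)^-1 : R)%:C)//.
by rewrite fmorphV rmorphXn rmorph_nat.
Qed.

(** Traciality turns multiplication by c on the right into a bounded left
    multiplication. *)
Lemma trace_norm_pproj_mul c : null (fun n => state_norm tau (p n * c)).
Proof.
apply: null_le (nullZ (cnorm_ge0 (star c)) trace_norm_pproj) => n.
by rewrite -(tracial_state_norm_star _ tau_tracial) starM pproj_star state_normM.
Qed.

End Trace.
End Automorphisms.

(** * Extension of the trace *)

Section TraceExtension.
Context {R : realType} {C : cstarType R} {iota : forall n, 'M[R[i]]_(qdim n) -> C}.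
Arguments iota : clear implicits.
Hypothesis C_CAR : CAR_algebra iota.
Variable tau : C -> R[i].
Hypothesis tau_trace : normalized_trace iota tau.
Variables (I : Type) (r : I) (phi : I -> C -> R[i]) (alpha : I -> C -> C).
Hypotheses (phi_state : forall i, is_state (phi i))
  (phi_r : product_state iota (phi r))
  (alpha_aut : forall i, star_automorphism (alpha i))
  (phi_alpha : forall i a, phi i (alpha i a) = phi r a)
  (alpha_r : forall a, alpha r a = a).
Local Notation q := (qproj iota).
Local Notation p i := (pproj iota (alpha i)).
Hypothesis phi_disjoint : forall i k c, i <> k ->
  null (fun n => state_norm (phi i) (p k n * c)).
Variables (A : cstarType R) (j : C -> A) (l : I -> A) (s : I -> nat -> C).
Hypotheses (jh : star_hom j)
  (l_coisometry : forall i, l i * star (l i) = 1)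
  (l_r : l r = 1)
  (l_source : forall i N, l i - j (s i N) = l i * j (p i N))
  (l_range : forall i N, l i - j (s i N) = j (q N) * l i)
  (A_gen : forall D, cstar_subalgebra D -> range j `|` range l `<=` D ->
     forall a, D a).
Variable v : A -> R[i].
Hypotheses (v_state : is_state v) (v_j : v \o j = phi r)
  (v_nondegenerate : forall a, (forall b, v (star (a * b) * (a * b)) = 0) -> a = 0).

Definition approximate_extensions (f : C -> R[i]) : set (nat -> A -> R[i]) :=
  [set om | (forall n, is_state (om n)) /\
     forall c, null (fun n => normc (om n (j c) - f c))].

Let W_state f om n : approximate_extensions f om -> is_state (om n).
Proof. by case=> + _; exact. Qed.

Lemma approximate_extensions_cst f om : is_state om -> om \o j = f ->
  approximate_extensions f (fun=> om).
Proof.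
by move=> os <-; split=> // c; apply: null_le null0 => n; rewrite subrr normc0.
Qed.

Let q_r n : p r n = q n. Proof. exact: alpha_r. Qed.

Lemma l_compress i N : l i * j (p i N) * star (l i) = j (q N).
Proof. by rewrite -l_source l_range -mulrA l_coisometry mulr1. Qed.

(** Conjugation by l i carries the projections q N to p i N, so it carries
    approximate extensions of phi r to states of C excised to phi i. *)
Lemma conjugate_limit i om c : approximate_extensions (phi r) om ->
  null (fun n => normc (om n (star (star (l i)) * j c * star (l i)) - phi i c)).
Proof.
move=> [os om_j]; move: c.
apply: (state_excision C_CAR phi_r (alpha_aut i) (phi_alpha i)
  (f := fun n c => om n (star (star (l i)) * j c * star (l i)))) => [n|N].
  apply: (state_pullback (om := fun a => om n (star (star (l i)) * a * star (l i)))) => //.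
  by apply: state_conjugate => //; rewrite starK l_coisometry (state1 (os n)).
rewrite starK l_compress; apply: null_le (om_j (q N)) => n.
by rewrite (product_state_qproj C_CAR phi_r).
Qed.

(** On the vector of phi r these produce the cyclic modules of all the phi i. *)
Definition orbit_set : set A := [set a | exists i c, a = j c * star (l i)].

Lemma orbit_set_mem i c : orbit_set (j c * star (l i)). Proof. by exists i, c. Qed.

(** The adjoints of the l i map the vector of phi r to vectors of the phi i, and
    the module that these generate under C is stable under the l k: the partial
    sum s k N acts by an element of C, and the remaining projection p k N tends
    to the rank one projection onto the i-th vector when k = i, and to 0 when
    k <> i. The adjoints of the l k act likewise, with q N = p r N in place of
    p k N. *)
Lemma orbit_approx_span a :
  approx_span (W := approximate_extensions (phi r)) orbit_set a.
Proof.
set W := approximate_extensions (phi r).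
have S1 : orbit_set 1 by exists r, 1; rewrite l_r star1 mulr1 (hom1 jh).
apply: (approx_span_full (@W_state (phi r)) A_gen) => //.
have lim i a' g (d : nat -> C) (x : nat -> A) :
    null (fun N => state_norm (phi i) (d N)) ->
    (forall N, approx_span (W := W) orbit_set (x N)) ->
    (forall N, a' - x N = g * (j (d N) * star (l i))) ->
    approx_span (W := W) orbit_set a'.
  move=> d0 xj ax.
  apply: (approx_span_limit (W := W) (@W_state (phi r)) jh (phi_state i) _ d0 xj ax).
  by move=> om c; exact: conjugate_limit.
have exc i c := state_excision_norm C_CAR phi_r (alpha_aut i) (phi_alpha i) c.
have inc i c := approx_span_incl (W := W) (orbit_set_mem i c).
have lin := @approx_span_linear _ _ W orbit_set.
move=> _ _ [[c _ <-]|[k _ <-]] [i [d ->]].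
  by rewrite -(hom_star jh) !mulrA -!(homM jh).
split.
- have [ik|ik] := pselect (i = k); last first.
    apply: (lim i _ (l k) _ (fun N => j (s k N * d) * star (l i)) (phi_disjoint d ik)) => // N.
    by rewrite !(homM jh) !mulrA -l_source !mulrBl.
  subst k.
  apply: (lim i _ (l i) _ (fun N => phi i d *: 1 + j (s i N * d) * star (l i)) (exc i d)) => N.
    by apply: lin => //; exact: approx_span_incl.
  rewrite (homB jh) (homZ jh) (hom1 jh) !(homM jh) mulrBl -scalerAl mul1r.
  rewrite mulrBr -scalerAr l_coisometry !mulrA -l_source opprD addrCA addrC.
  by rewrite !mulrBl.
- have lim_r N : star (l k) * (j d * star (l i)) - j (star (s k N) * d) * star (l i) =
      star (l k) * (j (q N * d) * star (l i)).
    rewrite !(homM jh) (hom_star jh) !mulrA -!mulrBl -starB l_range starM.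
    by rewrite -(hom_star jh) (qproj_star C_CAR).
  have [ir|ir] := pselect (i = r); last first.
    apply: (lim i _ (star (l k)) _ (fun N => j (star (s k N) * d) * star (l i))
      (phi_disjoint d ir)) => // N; rewrite q_r; exact: lim_r.
  subst i; apply: (lim r _ (star (l k)) _
    (fun N => phi r d *: (j 1 * star (l k)) + j (star (s k N) * d) * star (l r))
    (exc r d)) => [N|N]; first exact: lin.
  rewrite opprD addrCA lim_r q_r (homB jh) (homZ jh) (hom1 jh) mul1r.
  by rewrite mulrBl mulrBr addrC l_r star1 mulr1 -scalerAl mul1r -scalerAr mulr1.
Qed.

(** For i <> r the vectors in the modules of phi i and phi r are orthogonal,
    because q N tends to 1 on the state phi r and to 0 on the module of phi i. *)
Lemma orbit_limit a : orbit_set a ->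
  exists z, forall om, approximate_extensions (phi r) om -> null (fun n => normc (om n a - z)).
Proof.
move=> [i [c ->]]; have [->|ir] := pselect (i = r).
  exists (phi r c) => om [_]; rewrite l_r star1 => om_j.
  by under eq_fun do rewrite mulr1; exact: om_j.
exists 0 => om om_ext; have [os om_j] := om_ext.
have qs N : star (j (q N)) = j (q N) by rewrite -(hom_star jh) (qproj_star C_CAR).
have qq N : j (q N) * j (q N) = j (q N) by rewrite -(homM jh) (qprojK C_CAR).
set x := j c * star (l i) => e e0; have e3 : 0 < e / 3 by lra.
have [N _ /(_ N (leqnn N)) /= qN] := phi_disjoint c ir e3.
have x0 := nullZ (cnorm_ge0 x) (null_sqrt (om_j (q N))).
have e32 : 0 < (e / 3) ^+ 2 by rewrite exprn_gt0.
near=> n.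
have -> : om n x - 0 = om n (star (1 - j (q N)) * x) + om n (j (q N) * x).
  by rewrite subr0 -(stateD (os n)) starB star1 qs mulrBl mul1r subrK.
apply: le_trans (normcD _ _) _.
have h1 : normc (om n (star (1 - j (q N)) * x)) <= e / 3.
  apply: le_trans (state_cauchy_schwarz (os n) _ _) _.
  apply: (@le_trans _ _ (cnorm x * Num.sqrt (normc (om n (j (q N)) - phi r (q N))))).
    rewrite mulrC ler_pM ?state_norm_ge0 ?state_norm_le//.
    rewrite (product_state_qproj C_CAR phi_r).
    exact: (state_norm_complement (os n) (qs N) (qq N)).
  by near: n; exact: x0.
have h2 : normc (om n (j (q N) * x)) <= 2 * (e / 3).
  apply: le_trans (normc_le_state_norm (os n) _) _.
  rewrite -ler_sqr ?nnegrE ?state_norm_ge0//; last lra.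
  have : normc (om n (star (star (l i)) * j (star (q N * c) * (q N * c)) * star (l i)) -
      phi i (star (q N * c) * (q N * c))) <= (e / 3) ^+ 2.
    by near: n; exact: conjugate_limit.
  have -> : star (star (l i)) * j (star (q N * c) * (q N * c)) * star (l i) =
      star (j (q N) * x) * (j (q N) * x).
    by rewrite /x (homM jh) (hom_star jh) (homM jh) !starM !mulrA.
  rewrite -(state_norm_sqr (os n)) -(state_norm_sqr (phi_state i)) normc_realB.
  have : state_norm (phi i) (q N * c) ^+ 2 <= (e / 3) ^+ 2.
    by rewrite ler_sqr ?nnegrE ?state_norm_ge0 ?(ltW e3)// -q_r.
  by move=> h /ler_normlP[_]; rewrite [leRHS]exprMn; lra.
by lra.
Unshelve. all: by end_near. Qed.

(** In particular phi r has only one extension to a state of A. *)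
Lemma vector_determined a : determined (W := approximate_extensions (phi r)) a.
Proof.
exact: (approx_span_determined (@W_state (phi r)) orbit_limit) (orbit_approx_span a).
Qed.

(** Up to errors that tend to 0 for the trace, l i and its adjoint act on j(C) as
    j(s i N) and its adjoint, so j(C) is dense in A for every extension of the
    trace. *)
Lemma trace_approx_span a :
  approx_span (W := approximate_extensions tau) (range j) a.
Proof.
set W := approximate_extensions tau.
apply: (approx_span_full (@W_state tau) A_gen); last first.
  by exists 1 => //; exact: hom1.
have lim a' g (d : nat -> C) (x : nat -> A) :
    null (fun N => state_norm tau (d N)) ->
    (forall N, range j (x N)) ->
    (forall N, a' - x N = g * j (d N)) -> approx_span (W := W) (range j) a'.
  move=> d0 xj ax.
  apply: (approx_span_limit (W := W) (@W_state tau) (u := 1) (g := g) (x := x) jh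
    (trace_state tau_trace) _ d0).
  - move=> om c [_ omj]; apply: null_le (omj c) => n.
    by rewrite star1 mul1r mulr1.
  - by move=> N; apply: approx_span_incl.
  - by move=> N; rewrite mulr1.
move=> _ _ [[c _ <-]|[i _ <-]] [d _ <-].
  by rewrite -(hom_star jh) -!(homM jh); split; apply: approx_span_incl;
    [exists (c * d) | exists (star c * d)].
split.
  apply: (lim _ (l i) _ (fun N => j (s i N * d))
    (trace_norm_pproj_mul C_CAR (alpha_aut i) tau_trace d)) => [N|N].
    by exists (s i N * d).
  by rewrite !(homM jh) -mulrBl l_source mulrA.
apply: (lim _ (star (l i)) _ (fun N => j (star (s i N) * d))
  (trace_norm_pproj_mul C_CAR (alpha_aut r) tau_trace d)) => [N|N].
  by exists (star (s i N) * d).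
rewrite !(homM jh) (hom_star jh) -mulrBl -starB l_range starM -(hom_star jh).
by rewrite (qproj_star C_CAR) q_r mulrA.
Qed.

Lemma trace_determined a : determined (W := approximate_extensions tau) a.
Proof.
apply: (approx_span_determined (@W_state tau)) (trace_approx_span a).
by move=> _ [c _ <-]; exists (tau c) => om [_]; exact.
Qed.

Let avg n := v \o average (iota := iota) (j := j) n.

Lemma average_approximate_extension : approximate_extensions tau avg.
Proof.
have as_ n : is_state (avg n) by exact: (average_state C_CAR jh).
split=> //; apply: (states_cvg_CAR C_CAR (f := fun n => avg n \o j)) => [n||m a].
- exact: state_pullback.
- exact: trace_state tau_trace.
- apply: null_near null0; exists m => // n /= mn.
  have [b <-] := iota_le C_CAR a mn.
  rewrite /avg /= (average_iota C_CAR jh) (stateZ v_state) (state1 v_state) mulr1.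
  by rewrite (trace_iota tau_trace) subrr normc0.
Qed.

(** Instead of extending the trace by Hahn-Banach, average any state v of A over
    the matrix units of C_n: the averages extend the trace in the limit, and
    determination makes them converge at every element of A. *)
Lemma trace_extension_ex : exists t : A -> R[i],
  forall a, null (fun n => normc (avg n a - t a)).
Proof.
suff /choice[t tP] : forall a, exists z, null (fun n => normc (avg n a - z)) by exists t.
move=> a; have [] := @normc_complete _ (fun n => avg n a).
  move=> e e0; have e2 : 0 < e / 2 by lra.
  have [N aN] := @trace_determined a _ _ average_approximate_extension
    average_approximate_extension _ e2.
  exists N => m n Nm Nn; have := aN m n Nm Nn; lra.
by move=> z /null_cvg_for; exists z.
Qed.

Section Extension.
Variable t : A -> R[i].
Hypothesis t_lim : forall a, null (fun n => normc (avg n a - t a)).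

Lemma trace_extension_state : is_state t.
Proof.
by apply: limit_state t_lim => n; exact: (average_state C_CAR jh).
Qed.
Let ts := trace_extension_state.

Lemma trace_extension_j : t \o j = tau.
Proof.
have [_ avg_j] := average_approximate_extension.
by apply/funext => c; apply: null_normc_uniq (t_lim _) (avg_j c).
Qed.

Lemma trace_extension_uniq om : is_state om -> om \o j = tau -> t = om.
Proof.
move=> os oj; apply/funext => a; apply: null_normc_uniq (t_lim a) _ => e e0.
have [N aN] := @trace_determined a _ _ average_approximate_extension
  (approximate_extensions_cst os oj) _ e0.
by exists N => // n /= Nn; exact: (aN n n).
Qed.

Let sn_tj c : state_norm t (j c) = state_norm tau c.
Proof. by rewrite -(state_norm_comp t jh) trace_extension_j. Qed.

(** The n-th average commutes with C_n, hence its limit with the dense union.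
    Continuity in c is measured by tau, through the Cauchy-Schwarz inequality. *)
Lemma trace_extension_commutes c b : t (b * j c) = t (j c * b).
Proof.
move: c b; apply: (CAR_ind C_CAR) => [u m uZ um b|m a b].
  apply: (@null_normc_uniq _ (fun n => t (b * j (u n)))).
    apply: null_le (nullZ (state_norm_ge0 (om := t) (star b)) um) => n.
    rewrite -(stateB ts) -mulrBr -(homB jh) -[b in b * _]starK.
    apply: le_trans (state_cauchy_schwarz ts _ _) _.
    by rewrite ler_wpM2l ?state_norm_ge0// sn_tj (state_norm_le (trace_state tau_trace)).
  apply: null_le (nullZ (state_norm_ge0 (om := t) b) um) => n.
  rewrite uZ -(stateB ts) -mulrBl -(homB jh) -[u n - m]starK (hom_star jh).
  apply: le_trans (state_cauchy_schwarz ts _ _) _; rewrite mulrC.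
  rewrite ler_wpM2l ?state_norm_ge0// sn_tj starK.
  by rewrite -[leRHS]cnorm_starE (state_norm_le (trace_state tau_trace)).
apply: null_normc_uniq (t_lim _) _.
apply: null_near (t_lim (j (iota m a) * b)); exists m => // n /= mn.
by have [a' <-] := iota_le C_CAR a mn; rewrite /avg /= -(average_mulC C_CAR jh).
Qed.

(** It remains to commute l i with b. Both l i - j(s i N) = l i j(p i N) and
    l i - j(s i N) = j(q N) l i are small for the trace, the first on the right
    of b and the second on the left. *)
Lemma trace_extension_tracial : tracial t.
Proof.
suff H a b : t (b * a) = t (a * b) by move=> a b.
move: a b; apply: (A_gen (tracial_element_subalgebra ts)) => _ [[c _ <-]|[i _ <-]] b /=.
  exact: trace_extension_commutes.
apply/eqP; rewrite -subr_eq0; apply/eqP/normc_le0/null_cst.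
have Kp := nullZ (cnorm_ge0 (b * l i)) (trace_norm_pproj C_CAR (alpha_aut i) tau_trace).
have Kq := nullZ (cnorm_ge0 (l i * b)) (trace_norm_pproj C_CAR (alpha_aut r) tau_trace).
apply: null_le (nullD Kp Kq) => N.
have -> : t (b * l i) - t (l i * b) =
    t (b * l i * j (p i N)) - t (j (q N) * (l i * b)).
  rewrite -mulrA -l_source mulrA -l_range mulrBr mulrBl !(stateB ts).
  by rewrite trace_extension_commutes opprB addrA subrK.
apply: le_trans (normcD _ _) _; rewrite normc_opp q_r; apply: lerD.
  by rewrite -sn_tj; exact: state_projection_mul.
rewrite -sn_tj mulrC; apply: state_mul_projection => //.
by rewrite -(hom_star jh) (qproj_star C_CAR).
Qed.

(** If t(a^* a) = 0, traciality makes t vanish on the two-sided ideal of a^* a.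
    The states x |-> 2^n t(q n x q n) then vanish there too; but they restrict to
    states of C that the q N excise to phi r, so on all of A they converge to v.
    Hence v vanishes at every (a b)^* (a b), and a = 0. *)
Lemma trace_extension_faithful : faithful t.
Proof.
move=> a ta0.
have ta x : t (x * (star a * a)) = 0.
  have sn0 : state_norm t a = 0 by rewrite /state_norm ta0 sqrtr0.
  apply: normc_le0; rewrite mulrA -[x * star a]starK.
  by apply: le_trans (state_cauchy_schwarz ts _ _) _; rewrite sn0 mulr0.
(* The factor 2 ^ n normalizes, as q n has trace 2 ^ - n. *)
have scal n : (0 : R[i]) <= 2 ^+ n by rewrite exprn_ge0.
have qs n : star (j (q n)) = j (q n) by rewrite -(hom_star jh) (qproj_star C_CAR).
have qq n : j (q n) * j (q n) = j (q n) by rewrite -(homM jh) (qprojK C_CAR).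
pose psi n x := 2 ^+ n * t (j (q n) * x * j (q n)).
have tq n : 2 ^+ n * t (j (q n)) = 1.
  have -> : t (j (q n)) = tau (q n) by rewrite -trace_extension_j.
  by rewrite (trace_qproj tau_trace) mulfV// expf_neq0// pnatr_eq0.
have psi_state n : is_state (psi n).
  split=> [k x y|x|]; rewrite /psi.
  - rewrite mulrDr mulrDl -scalerAr -scalerAl (stateL ts) mulrDr.
    by rewrite mulrCA.
  - by rewrite mulr_ge0// -{1}qs mulrA -starM -mulrA (state_ge0 ts).
  - by rewrite mulr1 qq tq.
have psi_ext : approximate_extensions (phi r) psi.
  split=> //; apply: (product_state_excision C_CAR phi_r (f := fun n => psi n \o j)) => [n|N].
    exact: state_pullback.
  apply: null_near null0; exists N => // n /= Nn.
  rewrite /psi -!(homM jh).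
  have -> : q n * q N = q n.
    by rewrite -[LHS]starK starM !(qproj_star C_CAR) (qproj_mul C_CAR Nn) (qproj_star C_CAR).
  by rewrite (qprojK C_CAR) tq subrr normc0.
apply: v_nondegenerate => b; apply: null_normc_uniq (null_le _ null0).
  move=> e e0; have [N aN] := @vector_determined (star (a * b) * (a * b)) _ _
    (approximate_extensions_cst v_state v_j) psi_ext _ e0.
  by exists N => // n /= Nn; rewrite normc_distC; exact: (aN n n).
move=> n; rewrite subr0 /psi.
have -> : j (q n) * (star (a * b) * (a * b)) * j (q n) =
    j (q n) * star b * (star a * a) * (b * j (q n)) by rewrite starM !mulrA.
by rewrite trace_extension_tracial mulrA ta mulr0 normc0.
Qed.

Lemma tracial_state_uniq om : is_state om -> tracial om -> t = om.
Proof.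
move=> os ot; apply: trace_extension_uniq => //.
apply: (tracial_state_CAR C_CAR tau_trace); first exact: state_pullback.
by move=> a b /=; rewrite !(homM jh).
Qed.

End Extension.

(** The statement for A in terms of the relations between the l i and the
    projections p i N, q N alone. *)
Theorem unique_trace_extension : exists t : A -> R[i],
  [/\ unique (fun om : A -> R[i] => is_state om /\ om \o j = tau) t,
      tracial t, faithful t &
      unique (fun om : A -> R[i] => is_state om /\ tracial om) t].
Proof.
have [t t_lim] := trace_extension_ex; exists t.
have ts := trace_extension_state t_lim; have tt := trace_extension_tracial t_lim.
split=> //; last by split=> // om [os ot]; exact: (tracial_state_uniq t_lim).
- split=> [|om [os oj]]; first by split=> //; exact: trace_extension_j.
  exact: (trace_extension_uniq t_lim).
- exact: trace_extension_faithful.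
Qed.

End TraceExtension.

(** * Uniqueness of GNS representations *)

Section HilbertLimits.
Context {R : realType} {H : hilbertType R}.
Implicit Types (x y z : H) (u : nat -> H) (T : bop H) (M : set H).

Lemma hnorm_distC x y : hnorm (x - y) = hnorm (y - x).
Proof. by rewrite -hnormN opprB. Qed.

Lemma hnorm_dist x y z : hnorm (x - y) <= hnorm (x - z) + hnorm (z - y).
Proof. by rewrite (_ : x - y = (x - z) + (z - y)) ?hnormD// addrA subrK. Qed.

Lemma hnorm_le0 x : hnorm x <= 0 -> x = 0.
Proof. by move=> h; apply/eqP; rewrite -hnorm_eq0 eq_le h hnorm_ge0. Qed.

Lemma null_hnorm_uniq u x y :
  null (fun n => hnorm (u n - x)) -> null (fun n => hnorm (u n - y)) -> x = y.
Proof.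
move=> ux uy; apply/eqP; rewrite -subr_eq0; apply/eqP/hnorm_le0/null_cst.
by apply: null_le (nullD ux uy) => n; rewrite (hnorm_distC _ x) hnorm_dist.
Qed.

Lemma null_bop T u x :
  null (fun n => hnorm (u n - x)) -> null (fun n => hnorm (T (u n) - T x)).
Proof.
move=> ux; apply: null_le (nullZ (opnorm_ge0 T) ux) => n.
by rewrite -bopB opnorm_bound.
Qed.

Lemma null_dotp z u x :
  null (fun n => hnorm (u n - x)) -> null (fun n => normc (dotp (u n) z - dotp x z)).
Proof.
move=> ux; apply: null_le (nullZ (hnorm_ge0 z) ux) => n.
by rewrite -dotpBl mulrC hnorm_cauchy_schwarz.
Qed.

Lemma closure_hnorm M x : closure M x ->
  forall e : R, 0 < e -> exists2 y, M y & hnorm (x - y) < e.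
Proof.
move=> Mx e e0; have e0c : 0 < e%:C by rewrite ltcR.
have [y [My xy]] := Mx _ (nbhsx_ballx x _ e0c).
by exists y => //; move: xy; rewrite -ball_normE /= -hnormE ltcR.
Qed.

Lemma closed_hnorm M :
  (forall x, (forall e : R, 0 < e -> exists2 y, M y & hnorm (x - y) < e) -> M x) ->
  closed M.
Proof. by move=> Mx x /closure_hnorm; exact: Mx. Qed.

Lemma hnorm_dense_seq M x :
  (forall e : R, 0 < e -> exists2 y, M y & hnorm (x - y) < e) ->
  exists u, (forall n, M (u n)) /\ null (fun n => hnorm (u n - x)).
Proof.
move=> Mx; have /choice[u uP] : forall n : nat, exists y, M y /\ hnorm (x - y) < 2^-1 ^+ n.
  move=> n; have [|y] := Mx (2^-1 ^+ n); last by exists y.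
  by rewrite exprn_gt0// invr_gt0.
exists u; split=> [n|]; first exact: (uP n).1.
have /null_le : null (fun n => (2^-1 : R) ^+ n).
  by apply: null_expr; rewrite invr_ge0 ler0n invf_lt1// ltr1n.
by apply=> n; rewrite hnorm_distC ltW// (uP n).2.
Qed.

Lemma pointwise_limit_closed (T : nat -> bop H) (T' : bop H) (K : R) : 0 <= K ->
  (forall n x, hnorm (T n x) <= K * hnorm x) ->
  closed_subspace [set x | null (fun n => hnorm (T n x - T' x))].
Proof.
move=> K0 TK; split=> /=; last 2 first.
- by apply: null_le null0 => n; rewrite !bop0 subrr hnorm0.
- move=> k x y Tx Ty; apply: null_le (nullD (nullZ (normc_ge0 k) Tx) Ty) => n.
  by rewrite !bopD !bopZ opprD addrACA -scalerBr -hnormZ hnormD.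
apply: closed_hnorm => x xT e e0.
have c0 : 0 < K + opnorm T' + 1 by have := opnorm_ge0 T'; lra.
have e2 : 0 < e / 2 by lra.
have [y /= yT xy] := xT _ (divr_gt0 e2 c0).
near=> n.
have : hnorm (T n y - T' y) <= e / 2 by near: n; exact: yT.
move: xy; rewrite ltr_pdivlMr// => xy.
have := hnorm_dist (T n x) (T' x) (T n y).
have := hnorm_dist (T n y) (T' x) (T' y).
have := TK n (x - y); have := opnorm_bound T' (y - x); rewrite !bopB (hnorm_distC y x).
have := hnorm_ge0 (x - y); lra.
Unshelve. all: by end_near. Qed.

Lemma star_dotp T x y : dotp (T x) y = dotp x (star T y).
Proof. exact: adjP. Qed.

End HilbertLimits.

Section LinearIsometries.
Context {R : realType} {H K : hilbertType R} {U : H -> K}.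
Hypotheses (UL : linear U) (Un : forall x, hnorm (U x) = hnorm x).

(** Polarization. *)
Lemma isometry_dotp x y : dotp (U x) (U y) = dotp x y.
Proof.
have UD x' y' : U (x' + y') = U x' + U y' by have := UL 1 x' y'; rewrite !scale1r.
have U0 : U 0 = 0 by apply: (addrI (U 0)); rewrite -UD !addr0.
have UZ k x' : U (k *: x') = k *: U x' by have := UL k x' 0; rewrite U0 !addr0.
have Ux x' : dotp (U x') (U x') = dotp x' x' by rewrite -!hnorm_sqr Un.
have E k : Num.conj k * dotp (U x) (U y) + k * dotp (U y) (U x) =
    Num.conj k * dotp x y + k * dotp y x.
  have := Ux (x + k *: y); rewrite UD UZ !(dotpDl, dotpDr, dotpZl, dotpZr) !Ux.
  by move=> e; apply: (addrI (dotp x x)); apply: (addIr (k * (Num.conj k * dotp y y)));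
    rewrite -!addrA in e *.
have := E 1; have := E 'i; rewrite rmorph1 !mul1r.
case: (dotp (U x) (U y)) => a b; case: (dotp (U y) (U x)) => c d.
case: (dotp x y) => a' b'; case: (dotp y x) => c' d'.
by simpc => -[h1 h2] [h3 h4]; congr (_ +i* _)%C; lra.
Qed.

End LinearIsometries.

Section GNSUniqueness.
Context {R : realType} {A : starAlgType R} {H K : hilbertType R}.
Variables (pi : A -> bop H) (rho : A -> bop K) (xi : H) (y : K).
Hypotheses (pi_hom : star_hom pi) (rho_irr : irreducible_rep rho)
  (xi_cyclic : closure (range (fun a => pi a xi)) = setT)
  (y0 : y != 0) (pi_rho : forall a, dotp (rho a y) y = dotp (pi a xi) xi).

Let rho_hom : star_hom rho. Proof. by case: rho_irr. Qed.

Let same_norm a : hnorm (rho a y) = hnorm (pi a xi).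
Proof.
apply/eqP; rewrite -(@eqrXn2 _ 2) ?hnorm_ge0// -(inj_eq (@complexI R)) !hnorm_sqr.
rewrite star_dotp -bop_mulE -(hom_star rho_hom) -(homM rho_hom).
by rewrite dotpC pi_rho -dotpC (homM pi_hom) (hom_star pi_hom) bop_mulE -star_dotp.
Qed.

Let graph x z := exists u : nat -> A,
  null (fun n => hnorm (pi (u n) xi - x)) /\ null (fun n => hnorm (rho (u n) y - z)).

Let graph_norm x z : graph x z -> hnorm z = hnorm x.
Proof.
move=> [u [ux uz]]; apply/eqP; rewrite -subr_eq0 -normr_eq0 eq_le normr_ge0 andbT.
apply: null_cst; apply: null_le (nullD ux uz) => n.
have := hnormB_ge (pi (u n) xi) x; have := hnormB_ge (rho (u n) y) z.
have := hnormB_ge x (pi (u n) xi); have := hnormB_ge z (rho (u n) y).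
rewrite (hnorm_distC x) (hnorm_distC z) same_norm => *.
by apply/ler_normlP; split; lra.
Qed.

Let graph_linear k x z x' z' : graph x z -> graph x' z' ->
  graph (k *: x + x') (k *: z + z').
Proof.
move=> [u [ux uz]] [u' [ux' uz']]; exists (fun n => k *: u n + u' n); split.
  apply: null_le (nullD (nullZ (normc_ge0 k) ux) ux') => n.
  rewrite (homL pi_hom) bop_addE bop_scaleE opprD addrACA -scalerBr -hnormZ.
  exact: hnormD.
apply: null_le (nullD (nullZ (normc_ge0 k) uz) uz') => n.
rewrite (homL rho_hom) bop_addE bop_scaleE opprD addrACA -scalerBr -hnormZ.
exact: hnormD.
Qed.

Let graph_fun x z z' : graph x z -> graph x z' -> z = z'.
Proof.
move=> xz xz'; have := graph_norm (graph_linear (-1) xz xz').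
rewrite !scaleN1r addNr hnorm0 addrC => /eqP; rewrite hnorm_eq0 subr_eq0.
by move=> /eqP.
Qed.

Let graph_total x : exists z, graph x z.
Proof.
have [u [uP ux]] : exists u, (forall n, range (fun a => pi a xi) (u n)) /\
    null (fun n => hnorm (u n - x)).
  by apply: hnorm_dense_seq; apply: closure_hnorm; rewrite xi_cyclic.
have /choice[a aP] : forall n, exists a, pi a xi = u n.
  by move=> n; have [a _ <-] := uP n; exists a.
have [z /null_cvg_for az] : exists z, cvg_for hnorm (fun n => rho (a n) y) z.
  apply: hilbert_complete => e e0; have e3 : 0 < e / 3 by lra.
  have [N _ uN] := ux _ e3; exists N => m n Nm Nn.
  rewrite -bop_subE -(homB rho_hom) same_norm (homB pi_hom) bop_subE !aP.
  have := uN m Nm; have := uN n Nn; rewrite /=.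
  have := hnorm_dist (u m) (u n) x; rewrite (hnorm_distC x); lra.
by exists z, a; split=> //; under eq_fun do rewrite aP.
Qed.

Let graph_rep b x z : graph x z -> graph (pi b x) (rho b z).
Proof.
move=> [u [ux uz]]; exists (fun n => b * u n); split.
  by under eq_fun do rewrite (homM pi_hom) bop_mulE; exact: null_bop.
by under eq_fun do rewrite (homM rho_hom) bop_mulE; exact: null_bop.
Qed.

(** A cyclic representation is determined by its vector state: the relation
    between pi(a) xi and rho(a) y is isometric, so its closure is the graph of
    an isometry on the whole space, and irreducibility of rho makes it onto. *)
Lemma GNS_unitarily_equivalent : unitarily_equivalent pi rho.
Proof.
have /choice[U UP] := graph_total.
have UL : linear U by move=> k x x'; apply: graph_fun (UP _) (graph_linear _ (UP _) (UP _)).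
have Un x : hnorm (U x) = hnorm x by exact: graph_norm.
have Urep a x : U (pi a x) = rho a (U x) by apply: graph_fun (UP _) (graph_rep _ (UP _)).
exists U; split=> //; first exact: isometry_dotp.
have U0 : U 0 = 0 by apply/eqP; rewrite -hnorm_eq0 Un hnorm0.
have UB x x' : U (x - x') = U x - U x'.
  by have := UL (-1) x' x; rewrite !scaleN1r ![- _ + _]addrC.
have Usub : closed_subspace (range U).
  split; last 2 first.
  - by exists 0.
  - by move=> k _ _ [x _ <-] [x' _ <-]; exists (k *: x + x') => //; exact: UL.
  apply: closed_hnorm => z /hnorm_dense_seq[u [uU uz]].
  have /choice[x xu] : forall n, exists x, U x = u n.
    by move=> n; have [x _ <-] := uU n; exists x.
  have [l /null_cvg_for xl] : exists l, cvg_for hnorm x l.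
    apply: hilbert_complete => e e0; have e3 : 0 < e / 3 by lra.
    have [N _ uN] := uz _ e3; exists N => m n Nm Nn.
    rewrite -Un UB !xu; have := uN m Nm; have := uN n Nn; rewrite /=.
    have := hnorm_dist (u m) (u n) z; rewrite (hnorm_distC z); lra.
  exists l => //; apply: null_hnorm_uniq uz.
  by apply: null_le xl => n; rewrite -xu -UB Un.
have [_ /(_ _ Usub) irr] := rho_irr.
have y_range : range U y.
  exists xi => //; apply: graph_fun (UP _) _; exists (fun=> 1); split.
    by apply: null_le null0 => n; rewrite (hom1 pi_hom) subrr hnorm0.
  by apply: null_le null0 => n; rewrite (hom1 rho_hom) subrr hnorm0.
case: irr => [a _ [x _ <-]|range0|rangeT]; first by exists (pi a x).
  by move: y_range; rewrite range0 => /eqP; rewrite (negbTE y0).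
by move=> z _; rewrite -/(range U) rangeT.
Qed.

End GNSUniqueness.

(** * Strong sums of partial isometries *)

Section PartialIsometries.
Context {R : realType} {C : cstarType R}.

(** By the C*-identity the square of the norm of w - w e is the norm of
    (1 - e) e (1 - e) = 0. *)
Lemma partial_isometry_source (w e : C) :
  star e = e -> e * e = e -> star w * w = e -> w * e = w.
Proof.
move=> es ee we; apply/eqP; rewrite -subr_eq0; apply/eqP/cnorm_eq0.
apply/eqP; rewrite -sqrf_eq0 -cnorm_star starB starM es.
rewrite mulrBr !mulrBl -!mulrA [star w * (w * e)]mulrA we.
by rewrite !(mulrA, ee) !subrr cnorm0.
Qed.

Section Source.
Variables (p w : nat -> C).
Hypotheses (ps : forall n, star (p n) = p n)
  (pM : forall n m, (n <= m)%N -> p n * p m = p m)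
  (wp : forall n, star (w n) * w n = p n - p n.+1).

Let pMr n m : (n <= m)%N -> p m * p n = p m.
Proof. by move=> nm; rewrite -[LHS]starK starM !ps pM// ps. Qed.

Let we n : w n * (p n - p n.+1) = w n.
Proof.
apply: partial_isometry_source => //; first by rewrite starB !ps.
rewrite mulrBr !mulrBl (pM (leqnn n)) (pMr (leqnSn n)) (pM (leqnSn n)).
by rewrite (pM (leqnn n.+1)) subrr subr0.
Qed.

Lemma partial_isometry_mul_lt n N : (n < N)%N -> w n * p N = 0.
Proof.
by move=> nN; rewrite -we -mulrA mulrBl !pM// ?(ltnW nN)// subrr mulr0.
Qed.

Lemma partial_isometry_mul_ge n N : (N <= n)%N -> w n * p N = w n.
Proof.
by move=> Nn; rewrite -{1}we -mulrA mulrBl !pMr// ?(leqW Nn)// we.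
Qed.

Local Notation s N := (\sum_(0 <= n < N) w n).

Lemma partial_isometry_sum_mul N : s N * p N = 0.
Proof.
rewrite mulr_suml big_nat big1// => n /andP[_ nN].
exact: partial_isometry_mul_lt.
Qed.

Lemma partial_isometry_sum_tail N M : (N <= M)%N -> s M - s N = s M * p N.
Proof.
move=> NM; rewrite (big_cat_nat _ NM)//= mulrDl partial_isometry_sum_mul add0r.
rewrite addrAC subrr add0r mulr_suml !big_nat; apply: eq_bigr => n /andP[Nn _].
by rewrite partial_isometry_mul_ge.
Qed.

End Source.

Section SourceRange.
Variables (p q w : nat -> C).
Hypotheses (ps : forall n, star (p n) = p n) (qs : forall n, star (q n) = q n)
  (pM : forall n m, (n <= m)%N -> p n * p m = p m)
  (qM : forall n m, (n <= m)%N -> q n * q m = q m)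
  (p0 : p 0 = 1)
  (wp : forall n, star (w n) * w n = p n - p n.+1)
  (wq : forall n, w n * star (w n) = q n - q n.+1).
Local Notation s N := (\sum_(0 <= n < N) w n).

Let wq' n : star (star (w n)) * star (w n) = q n - q n.+1.
Proof. by rewrite starK. Qed.

Lemma mul_partial_isometry_sum N : q N * s N = 0.
Proof.
rewrite -[LHS]starK starM qs star_sum.
by rewrite (partial_isometry_sum_mul qs qM wq') star0.
Qed.

Lemma partial_isometry_sum_head N M : (N <= M)%N -> s M - s N = q N * s M.
Proof.
move=> NM; rewrite -[LHS]starK starB !star_sum.
by rewrite (partial_isometry_sum_tail qs qM wq' NM) starM qs -star_sum starK.
Qed.

Lemma partial_isometry_sum_sqr N : star (s N) * s N = 1 - p N.
Proof.
elim: N => [|N IH]; first by rewrite big_geq// star0 mul0r p0 subrr.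
rewrite big_nat_recr//= starD mulrDl !mulrDr IH wp.
have cross : star (w N) * s N = 0.
  rewrite -(partial_isometry_mul_ge qs qM wq' (leqnn N)) -mulrA.
  by rewrite mul_partial_isometry_sum mulr0.
rewrite cross add0r -[star (s N) * w N]starK starM starK cross star0 addr0.
by rewrite addrA subrK.
Qed.

End SourceRange.
End PartialIsometries.

Section StrongSum.
Context {R : realType} {C : cstarType R} {H : hilbertType R}.
Variables (Pi : C -> bop H) (p q w : nat -> C) (zeta eta : H) (S : bop H).
Local Notation s N := (\sum_(0 <= n < N) w n).
Hypotheses (Pi_hom : star_hom Pi)
  (ps : forall n, star (p n) = p n) (qs : forall n, star (q n) = q n)
  (pM : forall n m, (n <= m)%N -> p n * p m = p m)
  (qM : forall n m, (n <= m)%N -> q n * q m = q m)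
  (p0 : p 0 = 1) (q0 : q 0 = 1)
  (wp : forall n, star (w n) * w n = p n - p n.+1)
  (wq : forall n, w n * star (w n) = q n - q n.+1)
  (zeta1 : dotp zeta zeta = 1) (eta1 : dotp eta eta = 1)
  (p_lim : forall x, null (fun n => hnorm (Pi (p n) x - dotp x zeta *: zeta)))
  (q_lim : forall x, null (fun n => hnorm (Pi (q n) x - dotp x eta *: eta)))
  (S_lim : forall x, null (fun n => hnorm (Pi (s n) x - S x))).

Lemma projection_limit_fixed (u : nat -> C) (x : H) N :
  (forall n m, (n <= m)%N -> u n * u m = u m) -> dotp x x = 1 ->
  (forall y, null (fun n => hnorm (Pi (u n) y - dotp y x *: x))) ->
  Pi (u N) x = x.
Proof.
move=> uM x1 u_lim; have ux := u_lim x; rewrite x1 scale1r in ux.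
apply: null_hnorm_uniq (null_bop (Pi (u N)) ux) _.
apply: null_near ux; exists N => // n /= Nn.
by rewrite -bop_mulE -(homM Pi_hom) uM.
Qed.

(** An operator supported under all the projections is supported on the line
    to which they converge. *)
Lemma eq0_of_projection_limit (T : bop H) (u : nat -> C) (x : H) :
  (forall y, null (fun n => hnorm (Pi (u n) y - dotp y x *: x))) ->
  (forall n, T = T * Pi (u n)) -> T x = 0 -> T = 0.
Proof.
move=> u_lim Tu Tx; apply: bopP => y.
have Ty := null_bop T (u_lim y); rewrite bopZ Tx scaler0 in Ty.
apply: null_hnorm_uniq _ Ty; apply: null_le null0 => n.
by rewrite -bop_mulE -Tu subrr hnorm0.
Qed.

Let pz N : Pi (p N) zeta = zeta. Proof. exact: projection_limit_fixed. Qed.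
Let qe N : Pi (q N) eta = eta. Proof. exact: projection_limit_fixed. Qed.

Local Notation L := (S + theta eta zeta).

Lemma strong_sum_source N : L - Pi (s N) = L * Pi (p N).
Proof.
apply: bopP => x; rewrite bop_subE bop_mulE !bop_addE /= star_dotp -(hom_star Pi_hom).
rewrite ps pz addrAC; congr (_ + _).
have Sx : null (fun n => hnorm (Pi (s n) x - Pi (s N) x - (S x - Pi (s N) x))).
  by apply: null_le (S_lim x) => n; rewrite opprB addrA subrK.
apply: null_hnorm_uniq Sx _; apply: null_near (S_lim (Pi (p N) x)).
exists N => // n /= Nn.
have -> // : Pi (s n) x - Pi (s N) x = Pi (s n) (Pi (p N) x).
by rewrite -bop_subE -(homB Pi_hom) (partial_isometry_sum_tail ps pM wp Nn) (homM Pi_hom).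
Qed.

Lemma strong_sum_range N : L - Pi (s N) = Pi (q N) * L.
Proof.
apply: bopP => x; rewrite bop_subE bop_mulE !bop_addE /= bopD bopZ qe.
rewrite addrAC; congr (_ + _).
have Sx : null (fun n => hnorm (Pi (s n) x - Pi (s N) x - (S x - Pi (s N) x))).
  by apply: null_le (S_lim x) => n; rewrite opprB addrA subrK.
apply: null_hnorm_uniq Sx _; apply: null_near (null_bop (Pi (q N)) (S_lim x)).
exists N => // n /= Nn.
have -> // : Pi (s n) x - Pi (s N) x = Pi (q N) (Pi (s n) x).
by rewrite -bop_subE -(homB Pi_hom) (partial_isometry_sum_head qs qM wq Nn) (homM Pi_hom).
Qed.

Lemma strong_sum_zeta : L zeta = eta.
Proof.
rewrite bop_addE /= zeta1 scale1r -[RHS]add0r; congr (_ + _).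
apply: null_hnorm_uniq (S_lim zeta) _; apply: null_le null0 => n.
rewrite -(pz n) -bop_mulE -(homM Pi_hom) (partial_isometry_sum_mul ps pM wp).
by rewrite (hom0 Pi_hom) subr0 hnorm0.
Qed.

Lemma star_strong_sum_eta : star L eta = zeta.
Proof.
apply: dotp_inj => x; rewrite -star_dotp bop_addE /= dotpDl dotpZl eta1 mulr1.
rewrite -[RHS]add0r; congr (_ + _).
apply: null_normc_uniq (null_dotp eta (S_lim x)) _; apply: null_le null0 => n.
rewrite -(qe n) -qs (hom_star Pi_hom) -star_dotp -bop_mulE -(homM Pi_hom).
by rewrite (mul_partial_isometry_sum qs qM wq) (hom0 Pi_hom) dotp0l subrr normc0.
Qed.

(** The adjoint of L agrees with that of a partial sum on the range of 1 - q N,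
    and maps eta to zeta; these ranges and eta span a dense subspace. *)
Lemma strong_sum_coisometry : L * star L = 1.
Proof.
apply/eqP; rewrite -subr_eq0; apply/eqP.
apply: (eq0_of_projection_limit q_lim) => [N|]; last first.
  by rewrite bop_subE bop_mulE star_strong_sum_eta strong_sum_zeta subrr.
have wq' n : star (star (w n)) * star (w n) = q n - q n.+1 by rewrite starK.
have wp' n : star (w n) * star (star (w n)) = p n - p n.+1 by rewrite starK.
have ss : s N * star (s N) = 1 - q N.
  by have := partial_isometry_sum_sqr ps pM q0 wq' wp' N; rewrite -star_sum starK.
have Ls : L * star (Pi (s N)) = 1 - Pi (q N).
  have {1}-> : L = Pi (s N) + L * Pi (p N) by rewrite -strong_sum_source [RHS]addrC subrK.
  rewrite mulrDl -mulrA -!(hom_star Pi_hom) -!(homM Pi_hom) ss.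
  rewrite -[p N]ps -starM (partial_isometry_sum_mul ps pM wp) star0 (hom0 Pi_hom).
  by rewrite mulr0 addr0 (homB Pi_hom) (hom1 Pi_hom).
have E : star L = star (Pi (s N)) + star L * Pi (q N).
  by rewrite -[q N in RHS]qs (hom_star Pi_hom) -starM -starD -strong_sum_range [Pi _ + _]addrC subrK.
rewrite {1}E mulrDr Ls mulrBl mul1r mulrA.
by rewrite addrAC [1 - _]addrC addrK addrC.
Qed.

Lemma strong_sum_one : (forall n, w n = q n - q n.+1) -> zeta = eta -> L = 1.
Proof.
move=> w_q ze; apply/eqP; rewrite -subr_eq0; apply/eqP.
have sE N : s N = 1 - q N.
  under eq_bigr do rewrite w_q.
  elim: N => [|N IH]; first by rewrite big_geq// q0 subrr.
  by rewrite big_nat_recr//= IH addrA subrK.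
apply: (eq0_of_projection_limit q_lim) => [N|]; last first.
  have Le : L eta = eta by rewrite -{2}ze strong_sum_zeta.
  by rewrite bop_subE Le subrr.
have pq n : p n = q n.
  elim: n => [|n IH]; first by rewrite p0 q0.
  have := wp n; rewrite w_q starB !qs mulrBr !mulrBl.
  have -> : q n.+1 * q n = q n.+1 by rewrite -[LHS]starK starM !qs qM// qs.
  rewrite (qM (leqnn n)) (qM (leqnSn n)) (qM (leqnn n.+1)).
  rewrite subrr subr0 IH => /(addrI _)/oppr_inj; exact: esym.
have := strong_sum_source N; rewrite sE pq mulrBl mul1r => <-.
by rewrite (homB Pi_hom) (hom1 Pi_hom) opprB addrA addrAC addrK.
Qed.

End StrongSum.

(** * Generated C*-algebras *)

Section GeneratedSubalgebras.
Context {R : realType} {B : cstarType R} {G : set B}.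

(** The image of D in B is a C*-subalgebra containing G, since the generated
    algebra is itself closed. *)
Lemma cstar_gen_ind (D : set (cstar_gen G)) : cstar_subalgebra D ->
  (forall a : cstar_gen G, G (cstar_val a) -> D a) -> forall a, D a.
Proof.
move=> [D1 DL DM Ds Dlim] GD a.
pose E : set B := [set b | exists2 a, D a & cstar_val a = b].
suff [a' Da' /val_inj <-] : E (cstar_val a) by [].
apply: (cstar_val_gen a); split=> [|b Gb]; last first.
  by exists (CStarGen (cstar_gen_incl Gb)) => //; exact: GD.
split=> [|k _ _ [b Db <-] [c Dc <-]|_ _ [b Db <-] [c Dc <-]|_ [b Db <-]|u l Eu ul].
- by exists 1.
- by exists (k *: b + c) => //; exact: DL.
- by exists (b * c) => //; exact: DM.
- by exists (star b) => //; exact: Ds.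
- have /choice[b bP] : forall n, exists b, D b /\ cstar_val b = u n.
    by move=> n; have [b Db <-] := Eu n; exists b.
  have lG : l \in cstar_gen_pred G.
    apply/cstar_gen_predP; have [_ _ _ _ lim] := @cstar_gen_subalgebra _ _ G.
    by apply: lim ul => n; rewrite -(bP n).2; exact: cstar_val_gen.
  exists (CStarGen lG) => //; apply: (Dlim b) => [n|e /ul[N uN]]; first exact: (bP n).1.
  by exists N => n /uN; rewrite -(bP n).2.
Qed.

End GeneratedSubalgebras.

(** * Projections that excise a pure state *)

Section VectorStates.
Context {R : realType} {B : starAlgType R} {K : hilbertType R}.
Variables (rho : B -> bop K) (z : K).
Hypothesis rho_hom : star_hom rho.

Lemma dotp_rep_sqr a : dotp (rho (star a * a) z) z = (hnorm (rho a z) ^+ 2)%:C.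
Proof.
rewrite (homM rho_hom) (hom_star rho_hom) bop_mulE hnorm_sqr.
by rewrite star_dotp starK.
Qed.

Lemma vector_state : dotp z z = 1 -> is_state (fun a => dotp (rho a z) z).
Proof.
move=> z1; split=> [k a b|a|].
- by rewrite (homL rho_hom) bop_addE bop_scaleE dotp_linear.
- by rewrite dotp_rep_sqr ler0c sqr_ge0.
- by rewrite (hom1 rho_hom) z1.
Qed.

Lemma hnorm_rep (phi : B -> R[i]) a : (forall b, phi b = dotp (rho b z) z) ->
  hnorm (rho a z) = state_norm phi a.
Proof.
move=> phiE; rewrite /state_norm phiE dotp_rep_sqr /=.
by rewrite sqrtr_sqr ger0_norm ?hnorm_ge0.
Qed.

End VectorStates.

Section DecreasingProjections.
Context {R : realType} {C : cstarType R} {K : hilbertType R}.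
Variables (rho : C -> bop K) (p : nat -> C).
Hypotheses (rho_hom : star_hom rho) (ps : forall n, star (p n) = p n)
  (pM : forall n m, (n <= m)%N -> p n * p m = p m).

Lemma hnorm_projection n x : hnorm (rho (p n) x) <= hnorm x.
Proof.
have P1 : cnorm (rho (p n) : bop K) <= 1.
  apply: cnorm_projection; first by rewrite -(hom_star rho_hom) ps.
  by rewrite -(homM rho_hom) pM.
apply: le_trans (opnorm_bound _ _) _.
by rewrite ler_piMl ?hnorm_ge0.
Qed.

Lemma hnorm_projection_diff n m x : (n <= m)%N ->
  hnorm (rho (p n) x - rho (p m) x) ^+ 2 =
  hnorm (rho (p n) x) ^+ 2 - hnorm (rho (p m) x) ^+ 2.
Proof.
move=> nm; apply: complexI; rewrite rmorphB /= !hnorm_sqr.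
have E k l : dotp (rho (p k) x) (rho (p l) x) = dotp (rho (p l * p k) x) x.
  by rewrite (homM rho_hom) bop_mulE [RHS]star_dotp -(hom_star rho_hom) ps.
have pMr : p m * p n = p m by rewrite -[LHS]starK starM !ps pM// ps.
rewrite !(dotpBl, dotpBr) !E pMr !pM//.
by rewrite subrr subr0.
Qed.

(** The squared norms of rho (p n) x decrease, so the increments, whose squared
    norms are their differences, tend to 0. *)
Lemma decreasing_projections_limit x : exists y,
  null (fun n => hnorm (rho (p n) x - y)) /\ forall n, rho (p n) y = y.
Proof.
pose a n := hnorm (rho (p n) x) ^+ 2.
have a0 n : 0 <= a n by exact: sqr_ge0.
have inf_a : has_inf (range a).
  by split; [exists (a 0), 0 | exists 0 => _ [n _ <-]].
have tail e : 0 < e -> exists N, forall n, (N <= n)%N ->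
    hnorm (rho (p N) x - rho (p n) x) < e.
  move=> e0; have e2 : 0 < e ^+ 2 by rewrite exprn_gt0.
  have [_ [N _ <-] aN] := inf_adherent e2 inf_a.
  exists N => n Nn; rewrite -(@ltr_pXn2r _ 2) ?nnegrE ?hnorm_ge0 ?(ltW e0)//.
  rewrite hnorm_projection_diff//.
  have : inf (range a) <= a n by apply: (ge_inf inf_a.2); exists n.
  by move: aN; rewrite /a; lra.
have [y /null_cvg_for py] : exists y, cvg_for hnorm (fun n => rho (p n) x) y.
  apply: hilbert_complete => e e0; have e2 : 0 < e / 2 by lra.
  have [N pN] := tail _ e2; exists N => m n Nm Nn.
  have := pN m Nm; have := pN n Nn; rewrite (hnorm_distC _ (rho (p m) x)).
  have := hnorm_dist (rho (p m) x) (rho (p n) x) (rho (p N) x); lra.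
exists y; split=> // n; apply: null_hnorm_uniq (null_bop (rho (p n)) py) _.
apply: null_near py; exists n => // m /= nm.
by rewrite -bop_mulE -(homM rho_hom) pM.
Qed.

End DecreasingProjections.

Section ProjectionsOfPureState.
Context {R : realType} {C : cstarType R} {iota : forall n, 'M[R[i]]_(qdim n) -> C}.
Hypothesis C_CAR : CAR_algebra iota.
Variables (phi0 phi : C -> R[i]) (alpha : C -> C).
Hypotheses (phi0_prod : product_state iota phi0)
  (alpha_aut : star_automorphism alpha) (phi_alpha : forall a, phi (alpha a) = phi0 a).
Variables (K : hilbertType R) (pi : C -> bop K) (xi : K).
Hypothesis phi_GNS : GNS_triple phi pi xi.
Local Notation p := (pproj iota alpha).

Let ps := pproj_star C_CAR alpha_aut.
Let pM := pproj_mul C_CAR alpha_aut.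

Lemma projection_limit_cyclic x :
  null (fun n => hnorm (pi (p n) x - dotp x xi *: xi)).
Proof.
have [pi_hom xi_cyclic phiE] := phi_GNS.
have p1 n y : hnorm (pi (p n) y) <= 1 * hnorm y.
  by rewrite mul1r; exact: (hnorm_projection _ ps pM).
have [Mcl _ _] := @pointwise_limit_closed _ _ _ (theta xi xi) _ ler01 p1.
suff : closure (range (fun a => pi a xi)) x.
  move=> /(closure_subset _) xM; apply: Mcl; apply: xM => _ [c _ <-] /=.
  apply: null_le (state_excision_norm C_CAR phi0_prod alpha_aut phi_alpha c) => n.
  rewrite -(hnorm_rep pi_hom _ phiE) (homB pi_hom) (homZ pi_hom) (hom1 pi_hom).
  by rewrite (homM pi_hom) phiE.
by rewrite xi_cyclic.
Qed.

(** A nonzero limit of rho (p n) x would be fixed by all p n; its vector state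
    would be excised to phi, and rho would be equivalent to the GNS
    representation of phi. *)
Lemma projection_limit_disjoint (K' : hilbertType R) (rho : C -> bop K') :
  irreducible_rep rho -> ~ unitarily_equivalent pi rho ->
  forall x, null (fun n => hnorm (rho (p n) x)).
Proof.
move=> rho_irr pi_rho x; have [rho_hom _] := rho_irr.
have [pi_hom xi_cyclic phiE] := phi_GNS.
have [y [py fix_y]] := decreasing_projections_limit rho_hom ps pM x.
suff y0 : y = 0 by apply: null_le py => n; rewrite y0 subr0.
apply/eqP/negPn/negP => y0; apply: pi_rho.
have hy : hnorm y != 0 by rewrite hnorm_eq0.
pose z := (hnorm y)^-1%:C *: y.
have z1 : dotp z z = 1.
  rewrite -hnorm_sqr hnormZ normc_real ger0_norm ?invr_ge0 ?hnorm_ge0//.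
  by rewrite mulVf// expr1n.
have zs := vector_state rho_hom z1.
have z_phi a : dotp (rho a z) z = phi a.
  have := state_excision C_CAR phi0_prod alpha_aut phi_alpha
    (f := fun _ a => dotp (rho a z) z) (fun=> zs).
  move=> /(_ _ a)/null_cst h; apply/eqP; rewrite -subr_eq0; apply/eqP/normc_le0/h.
  move=> N; apply: null_le null0 => n.
  by rewrite bopZ fix_y z1 subrr normc0.
apply: (@GNS_unitarily_equivalent _ _ _ _ pi rho xi z) => // [|a].
  by apply: contraNneq (oner_neq0 R[i]) => z0; rewrite -z1 z0 dotp0l.
by rewrite z_phi phiE.
Qed.

End ProjectionsOfPureState.

Lemma unitarily_equivalent_refl (R : realType) (B : starAlgType R)
  (K : hilbertType R) (rho : B -> bop K) : unitarily_equivalent rho rho.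
Proof. by exists id; split=> // x _; exists x. Qed.

Section DirectSum.
Context {R : realType} {C : cstarType R} {I : Type} {HI : I -> hilbertType R}.
Context {H : hilbertType R} {V : forall i, HI i -> H}.
Arguments V : clear implicits.
Hypothesis H_sum : hilbert_direct_sum V.

Lemma direct_sum_hnorm i x : hnorm (V i x) = hnorm x.
Proof.
have [_ Vd _ _] := H_sum; apply/eqP; rewrite -(@eqrXn2 _ 2) ?hnorm_ge0//.
by rewrite -(inj_eq (@complexI R)) !hnorm_sqr Vd.
Qed.

Lemma direct_sumB i x y : V i (x - y) = V i x - V i y.
Proof.
have [VL _ _ _] := H_sum.
by have := VL i (-1) y x; rewrite !scaleN1r ![- _ + _]addrC.
Qed.

Lemma direct_sumZ i k x : V i (k *: x) = k *: V i x.
Proof.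
have [VL _ _ _] := H_sum; have V0 : V i 0 = 0.
  by rewrite -(subrr (0 : HI i)) direct_sumB subrr.
by have := VL i k x 0; rewrite V0 !addr0.
Qed.

Lemma direct_sum_projection_limit (pi : forall i, C -> bop (HI i)) (Pi : C -> bop H)
    (p : nat -> C) i (xi : HI i) : star_hom Pi ->
  (forall n, star (p n) = p n) -> (forall n m, (n <= m)%N -> p n * p m = p m) ->
  (forall a k x, Pi a (V k x) = V k (pi k a x)) ->
  (forall x, null (fun n => hnorm (pi i (p n) x - dotp x xi *: xi))) ->
  (forall k x, i <> k -> null (fun n => hnorm (pi k (p n) x))) ->
  forall x, null (fun n => hnorm (Pi (p n) x - dotp x (V i xi) *: V i xi)).
Proof.
move=> Pi_hom ps pM PiV lim_i lim_k x.
have p1 n y : hnorm (Pi (p n) y) <= 1 * hnorm y.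
  by rewrite mul1r; exact: (hnorm_projection _ ps pM).
have Mcl := @pointwise_limit_closed _ _ _ (theta (V i xi) (V i xi)) _ ler01 p1.
have [_ Vd Vo Vdense] := H_sum.
have := Vdense _ Mcl; set M := (X in X = setT) => MT.
suff : M x by [].
rewrite MT// => k y; rewrite /M /=.
have [ik|ik] := pselect (i = k).
  subst k; apply: null_le (lim_i y) => n.
  by rewrite PiV Vd -direct_sumZ -direct_sumB direct_sum_hnorm.
apply: null_le (lim_k k y ik) => n.
by rewrite PiV Vo ?scale0r ?subr0 ?direct_sum_hnorm// => ki; apply: ik.
Qed.

End DirectSum.

(** * The unique trace *)

Theorem theorem5p3 (R : realType)
    (* the CAR algebra and its normalized trace *)
    (C : cstarType R) (iota : forall n, 'M[R[i]]_(qdim n) -> C)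
    (C_CAR : CAR_algebra iota)
    (tau : C -> R[i]) (tau_trace : normalized_trace iota tau)
    (* pure states and their GNS triples *)
    (I : Type) (r : I)
    (phi : I -> C -> R[i])
    (phi_pure : forall i, pure_state (phi i))
    (phi_r : product_state iota (phi r))
    (HI : I -> hilbertType R) (pi : forall i, C -> bop (HI i))
    (xi : forall i, HI i)
    (phi_GNS : forall i, GNS_triple (phi i) (pi i) (xi i))
    (pi_reps : irreducible_representatives pi)
    (* asymptotically inner automorphisms *)
    (alpha : I -> C -> C)
    (alpha_aut : forall i, star_automorphism (alpha i))
    (phi_alpha : forall i a, phi i (alpha i a) = phi r a)
    (alpha_r : forall a, alpha r a = a)
    (alpha_inner : forall i, asymptotically_inner (alpha i))
    (* partial isometries *)
    (w : I -> nat -> C)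
    (w_source : forall i n, star (w i n) * w i n = eproj iota (alpha i) n)
    (w_range : forall i n, w i n * star (w i n) = fproj iota n)
    (w_r : forall n, w r n = fproj iota n)
    (* the direct sum representation *)
    (H : hilbertType R) (V : forall i, HI i -> H)
    (H_sum : hilbert_direct_sum V)
    (Pi : C -> bop H) (Pi_hom : star_hom Pi)
    (Pi_sum : forall a i x, Pi a (V i x) = V i (pi i a x))
    (* S i is the strong limit of the partial sums of the w i *)
    (S : I -> bop H)
    (S_lim : forall i x,
      (fun N => Pi (\sum_(0 <= n < N) w i n) x) @ \oo --> S i x) :
  let L := fun i => S i + theta (V r (xi r)) (V i (xi i)) in
  let A := algA Pi L in
  let j : C -> A := algA_incl Pi L in
  exists tau' : A -> R[i],
    [/\ unique (fun om : A -> R[i] => is_state om /\ om \o j = tau) tau',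
        tracial tau',
        faithful tau' &
        unique (fun om : A -> R[i] => is_state om /\ tracial om) tau'].
Proof.
set L : I -> bop H := fun i => S i + theta (V r (xi r)) (V i (xi i)).
move=> L' A j.
have phi_state i : is_state (phi i) by case: (phi_pure i).
have alpha_hom i : star_hom (alpha i) by case: (alpha_aut i).
have [pi_irr pi_uniq] := pi_reps.
have pi_disjoint i k : i <> k -> ~ unitarily_equivalent (pi i) (pi k).
  move=> ik e; have [i0 [_ i0_uniq]] := pi_uniq _ _ (pi_irr k).
  by apply: ik; rewrite -(i0_uniq _ e) -(i0_uniq _ (unitarily_equivalent_refl _)).
pose q := qproj iota; pose p i := pproj iota (alpha i).
have ps i n : star (p i n) = p i n by exact: pproj_star.
have pM i n m : (n <= m)%N -> p i n * p i m = p i m by exact: pproj_mul.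
have p0 i : p i 0 = 1 by rewrite /p /pproj (qproj0 C_CAR) (hom1 (alpha_hom i)).
have pr n : p r n = q n by exact: alpha_r.
have p_disjoint i k x : i <> k -> null (fun n => hnorm (pi k (p i n) x)).
  by move=> ik; apply: (projection_limit_disjoint C_CAR phi_r (alpha_aut i) (phi_alpha i)
       (phi_GNS i) (pi_irr k)); exact: pi_disjoint.
pose zeta i := V i (xi i).
have [_ Vd _ Vdense] := H_sum.
have zeta1 i : dotp (zeta i) (zeta i) = 1.
  have [pi_hom _ phiE] := phi_GNS i.
  by rewrite Vd -[RHS](state1 (phi_state i)) phiE (hom1 pi_hom).
have p_lim i x : null (fun n => hnorm (Pi (p i n) x - dotp x (zeta i) *: zeta i)).
  apply: (direct_sum_projection_limit H_sum Pi_hom (ps i) (pM i) Pi_sum) => [y|k y].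
    exact: (projection_limit_cyclic C_CAR phi_r (alpha_aut i) (phi_alpha i) (phi_GNS i)).
  exact: p_disjoint.
pose s i N := \sum_(0 <= n < N) w i n.
have s_lim i x : null (fun N => hnorm (Pi (s i N) x - S i x)).
  by apply/null_cvg_for/cvg_for_dist; exact: S_lim.
have wq i n : w i n * star (w i n) = p r n - p r n.+1 by rewrite !pr w_range.
have L_source i N : L i - Pi (s i N) = L i * Pi (p i N).
  exact: (strong_sum_source _ Pi_hom (ps i) (pM i) (w_source i) (zeta1 i) (p_lim i) (s_lim i)).
have L_range i N : L i - Pi (s i N) = Pi (q N) * L i.
  rewrite -pr.
  exact: (strong_sum_range _ Pi_hom (ps r) (pM r) (wq i) (zeta1 r) (p_lim r) (s_lim i)).
have L_co i : L i * star (L i) = 1.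
  exact: (strong_sum_coisometry Pi_hom (ps i) (ps r) (pM i) (pM r) (p0 r)
    (w_source i) (wq i) (zeta1 i) (zeta1 r) (p_lim i) (p_lim r) (s_lim i)).
have L_one : L r = 1.
  apply: (strong_sum_one Pi_hom (ps r) (ps r) (pM r) (pM r) (p0 r) (p0 r)
    (w_source r) (zeta1 r) (p_lim r) (p_lim r) (s_lim r)) => // n.
  by rewrite !pr w_r.
have star_L i : star (L i) (zeta r) = zeta i.
  exact: (star_strong_sum_eta (zeta i) Pi_hom (ps r) (pM r) (wq i) (zeta1 r)
    (p_lim r) (s_lim i)).
pose l i : A := CStarGen (cstar_gen_incl (or_intror (imageT L i))).
have jh : star_hom j.
  split=> [k a b||a b|a]; apply: val_inj => /=.
  - exact: (homL Pi_hom).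
  - exact: (hom1 Pi_hom).
  - exact: (homM Pi_hom).
  - exact: (hom_star Pi_hom).
have A_gen (D : set A) : cstar_subalgebra D -> range j `|` range l `<=` D ->
    forall a, D a.
  move=> Dsub jlD; apply: (cstar_gen_ind Dsub) => a [[c _ ca]|[i _ ia]]; apply: jlD.
    by left; exists c => //; exact: val_inj.
  by right; exists i => //; exact: val_inj.
have val_hom : star_hom (fun a : A => cstar_val a) by split.
pose v (a : A) := dotp (cstar_val a (zeta r)) (zeta r).
have v_state : is_state v by exact: (vector_state val_hom).
have v_j : v \o j = phi r.
  have [_ _ phiE] := phi_GNS r.
  by apply/funext => c; rewrite /v /= /zeta Pi_sum Vd phiE.
have v_nondegenerate (a : A) :
    (forall b, v (star (a * b) * (a * b)) = 0) -> a = 0.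
  move=> va; have ab0 (b : A) : cstar_val a (cstar_val b (zeta r)) = 0.
    have := va b; rewrite /v (dotp_rep_sqr _ val_hom) => /complexI/eqP.
    by rewrite sqrf_eq0 hnorm_eq0 => /eqP.
  apply: val_inj; apply: bopP => x /=.
  have a_bound (n : nat) y : hnorm (cstar_val a y) <= opnorm (cstar_val a) * hnorm y.
    exact: opnorm_bound.
  (* The kernel of a is closed and contains V i (pi i c (xi i)), which is the
     image of zeta r under j c * star (l i); so it is everything. *)
  have Mcl := pointwise_limit_closed (0 : bop H) (opnorm_ge0 _) a_bound.
  have M0 y : null (fun=> hnorm (cstar_val a y - (0 : bop H) y)) -> cstar_val a y = 0.
    by rewrite subr0 => /null_cst/hnorm_le0.
  apply: M0; have := Vdense _ Mcl; set M := (X in X = setT) => MT.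
  suff : M x by []; rewrite MT// => i y; rewrite /M /= subr0.
  have [pi_hom xi_cyclic _] := phi_GNS i.
  have [u [u_range uy]] : exists u, (forall n, range (fun c => pi i c (xi i)) (u n)) /\
      null (fun n => hnorm (u n - y)).
    by apply: hnorm_dense_seq; apply: closure_hnorm; rewrite xi_cyclic.
  apply: null_le (nullZ (opnorm_ge0 (cstar_val a)) uy) => n.
  have [c _ cu] := u_range n.
  have au : cstar_val a (V i (u n)) = 0.
    rewrite -cu -Pi_sum -/(zeta i) -(star_L i); exact: (ab0 (j c * star (l i))).
  rewrite -hnormN -[- _]add0r -au -bopB -(direct_sumB H_sum).
  by rewrite -(direct_sum_hnorm H_sum) opnorm_bound.
have phi_disjoint i k c : i <> k -> null (fun n => state_norm (phi i) (p k n * c)).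
  move=> ik; have [pi_hom _ phiE] := phi_GNS i.
  apply: null_le (p_disjoint k i (pi i c (xi i)) (nesym ik)) => n.
  by rewrite -(hnorm_rep pi_hom _ phiE) (homM pi_hom).
apply: (unique_trace_extension C_CAR tau_trace phi_state phi_r alpha_aut phi_alpha
  alpha_r phi_disjoint jh _ _ _ _ A_gen v_state v_j v_nondegenerate (l := l) (s := s)).
- by move=> i; apply: val_inj; exact: L_co.
- by apply: val_inj; exact: L_one.
- by move=> i N; apply: val_inj; exact: L_source.
- by move=> i N; apply: val_inj; exact: L_range.
Qed.
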